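(* Let $n>1$ and $d\ge 2$ be integers, let $r\in\{1,-1\}$ with $n\equiv r\pmod d$, and let $a,c,e$ be indeterminates. Define \begin{align*} Q_q(a,n)&=\frac{{q^{r(r-n)/d}}\left(1-aq^n\right)\left(a-q^n\right)}{(1-a)^2} \left\{\frac{1}{\left(q^d;q^d\right)_{(n-r)/d}}-\frac{\left(q^d;q^d\right)_{(n-r)/d}}{\left(q^d/a,aq^d;q^d\right)_{(n-r)/d}}\right\} +\frac{q^{r(r-n)/d}}{\left(q^d;q^d\right)_{(n-r)/d}}. \end{align*} Then, modulo $\Phi_n(q)^2(1-aq^n)(a-q^n)$, \begin{align*} &\sum_{k=0}^{(n-r)/d}[2dk+r]\frac{\left(q^r;q^d\right)^2_k\left(cq^r,eq^r,aq^r,q^r/a;q^d\right)_k} {\left(q^d;q^d\right)^2_k\left(q^d/c,q^d/e,q^d/a,aq^d;q^d\right)_k} \left(\frac{q^{2d-3r}}{ce}\right)^k\\ &\equiv[n]Q_q(a,n) \sum_{k=0}^{(n-r)/d}\frac{\left(q^{2r+dk};q^d\right)_{(n-r)/d-k}\left(q^{d-r}/(ce),aq^r,q^r/a,q^r;q^d\right)_k}{\left(q^d,q^d/c,q^d/e;q^d\right)_k}q^{dk}. \end{align*}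
   Context: $q$ is an indeterminate. The $q$-shifted factorial is $(x;q)_0=1$, $(x;q)_m=(1-x)(1-xq)\cdots(1-xq^{m-1})$ for positive integers $m$, and $(x_1,\dots,x_s;q)_m=(x_1;q)_m\cdots(x_s;q)_m$; $(x;q)_m^j$ means $((x;q)_m)^j$. For an integer $m$, $[m]=(1-q^m)/(1-q)$. $\Phi_n(q)$ is the $n$-th cyclotomic polynomial. For rational functions $A,B$ in $q,a,c,e$ and a polynomial $P$, $A\equiv B \pmod P$ means that $A-B=P\cdot F/G$ with $F,G$ polynomials and $G$ coprime to $P$. *)

(* Defs.v *)
From HB Require Import structures.
From mathcomp Require Import all_boot all_order all_algebra.
From mathcomp Require Import cyclotomic fraction.
Set Implicit Arguments. Unset Strict Implicit. Unset Printing Implicit Defensive.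
Import Order.TTheory GRing.Theory Num.Theory.
Local Open Scope ring_scope.

(* Polynomial ring Q[q,a,c,e] as nested univariate polynomials, and its
   field of fractions (rational functions in q,a,c,e). *)
Notation P := ({poly {poly {poly {poly rat}}}}).
Notation K := ({fraction P}).
Notation "x %:F" := (@FracField.tofrac P x) : ring_scope.

Definition eP : P := 'X.
Definition cP : P := ('X)%:P.
Definition aP : P := ('X)%:P%:P.
Definition qP : P := ('X)%:P%:P%:P.

Definition qv : K := qP%:F.
Definition av : K := aP%:F.
Definition cv : K := cP%:F.
Definition ev : K := eP%:F.

Definition PhiP (n : nat) : P := (map_poly (fun z : int => z%:~R) 'Phi_n).[qP].

Definition dvdP (D X : P) : Prop := exists Y : P, X = D * Y.
Definition coprimeP (G M : P) : Prop :=
  forall D : P, dvdP D G -> dvdP D M -> D \is a GRing.unit.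

Definition congr_mod (A B : K) (M : P) : Prop :=
  exists F G : P, G != 0 /\ coprimeP G M /\ A - B = (M%:F * F%:F) / G%:F.

Definition poch (x y : K) (m : nat) : K := \prod_(i < m) (1 - x * y ^+ i).

Definition qint (m : int) : K := (1 - qv ^ m) / (1 - qv).

(* Q_q(a,n), where N = (n - r)/d *)
Definition Qq (n d : nat) (r : int) (N : nat) : K :=
  let qd := qv ^+ d in
  let t := qv ^ ((r * (r - n%:Z)) %/ d%:Z)%Z in
  t * (1 - av * qv ^+ n) * (av - qv ^+ n) / (1 - av) ^+ 2 *
    (1 / poch qd qd N - poch qd qd N / (poch (qd / av) qd N * poch (av * qd) qd N))
  + t / poch qd qd N.

(* Main.v *)
(** Put p = q^d, Y = q^r, u = q^n, so that u = Y p^N with N = (n - r)/d.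

    Modulo a - u or 1 - a u, replace a by u or 1/u.  The left-hand series then
    terminates by itself and Watson's 8phi7 transformation evaluates it exactly;
    the bracket in Q_q(a,n) is killed by its factor (1 - a q^n)(a - q^n).

    Modulo Phi_n(q)^2, twist one of the two factors (Y;p)_k/(p;p)_k of the
    left-hand side into u^k (p^-N;p)_k/(pu;p)_k, which again makes Watson's
    transformation applicable.  With h = 1 - u, divisible by Phi_n(q), undoing it
    multiplies the k-th term, up to O(h^2), by 1 + h E_k with E_k = E_(N-k), while
    modulo Phi_n(q) the k-th and the (N-k)-th terms are opposite (specialize Y to
    p^-N); hence the twist does not change the sum modulo Phi_n(q)^2.  Since
    Watson's formula for the twisted sum carries the factor 1 - u, it only
    remains to compare the other factors modulo Phi_n(q), where Y = p^-N.

    The congruences live in the localization of Q[q,a,c,e] at the three primes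
    Phi_n(q), 1 - a q^n and a - q^n, which are the kernels of the specializations
    q = zeta_n, a = q^-n and a = q^n. *)

Require Import Defs.
From HB Require Import structures.
From mathcomp Require Import all_boot all_order all_algebra.
From mathcomp Require Import cyclotomic fraction algC.
From mathcomp Require Import ring zify.
Import Order.TTheory GRing.Theory Num.Theory.
Local Open Scope ring_scope.

(** * Basic hypergeometric series *)

(** The twist is dictated by Watson's formula. With the parameters cY, eY, aY, Y/a its argument is u
    p^2/(Y^3 c e), so the terminating pair (p^-N;p)_k/(pu;p)_k must bring the power u^k along; since
    Y = u p^-N, the new factor agrees with (Y;p)_k/(p;p)_k at u = 1. The same power makes E_k
    symmetric: without u^k it would be H_k - k + H_(N-k) - H_N, with H_k the sum of 1/(1 - p^i) over
    1 <= i <= k, and opposite terms would no longer cancel.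

    Q_q(a,n) is a Chinese-remainder interpolation. The quotient (1 - au)(a - u)/(1 - a)^2 is 0
    modulo 1 - au and a - u, but -1 modulo Phi_n(q). So Q_q(a,n) is Y^-N/(p;p)_N at the two primes
    containing a, the constant of Watson's formula at a = u, and Y^-N (p;p)_N/((p/a;p)_N (ap;p)_N)
    modulo Phi_n(q), matching the prefactor of the twisted sum. *)

Definition qpoch (F : fieldType) (x y : F) (m : nat) : F :=
  \prod_(i < m) (1 - x * y ^+ i).
Arguments qpoch {F} x y m.

Lemma qpoch0 (F : fieldType) (x y : F) : qpoch x y 0 = 1.
Proof. exact: big_ord0. Qed.

Lemma qpochS (F : fieldType) (x y : F) m :
  qpoch x y m.+1 = qpoch x y m * (1 - x * y ^+ m).
Proof. exact: big_ord_recr. Qed.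

Lemma qpochD (F : fieldType) (x y : F) m l :
  qpoch x y (m + l) = qpoch x y m * qpoch (x * y ^+ m) y l.
Proof.
rewrite /qpoch big_split_ord /=; congr (_ * _).
by apply: eq_bigr => i _; rewrite exprD mulrA.
Qed.

Lemma qpoch_neq0 (F : fieldType) (x y : F) m :
  (forall i, 1 - x * y ^+ i != 0) -> qpoch x y m != 0.
Proof. by move=> h; apply/prodf_neq0 => i _. Qed.

(* The q-Saalschuetz summand, with [p^-M] eliminated by reversing the order of
   the factors it enters: this avoids the denominators that vanish for r = -1, d = 2. *)
Definition saal_term (F : fieldType) (p x y z : F) (M i : nat) : F :=
  qpoch x p i * qpoch y p i * qpoch z p (M - i) * z ^+ i
  / (qpoch p p (M - i) * qpoch p p i * qpoch (x * y * z) p i).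
Arguments saal_term {F} p x y z M i.

(** Creative telescoping: the summand satisfies a first-order recurrence in M up to a difference in
    i, and the right-hand side is the accumulated certificate. *)
Lemma saal_telescope (F : fieldType) (p x y z : F) (M j : nat) :
  p != 0 ->
  (forall i, 1 - p * p ^+ i != 0) -> (forall i, 1 - x * y * z * p ^+ i != 0) ->
  (j <= M)%N ->
  (1 - p ^+ M.+1) * (1 - x * y * z * p ^+ M)
    * (\sum_(i < j.+1) saal_term p x y z M.+1 i)
  - (1 - x * z * p ^+ M) * (1 - y * z * p ^+ M)
    * (\sum_(i < j.+1) saal_term p x y z M i)
  = - z * p ^+ (M - j) * (1 - x * p ^+ j) * (1 - y * p ^+ j)
    * saal_term p x y z M j.
Proof.
move=> p0 hp hc; elim: j => [|j IHj] lejM.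
  rewrite !big_ord1 /saal_term !subn0 !qpoch0 !qpochS !expr0 exprS.
  have h1 := hp M; have h2 := @qpoch_neq0 _ p p M hp.
  by field; rewrite h1 h2.
have /IHj {}IHj : (j <= M)%N := ltnW lejM.
have [l defM] : exists l, M = (j.+1 + l)%N by exists (M - j.+1)%N; rewrite subnKC.
rewrite big_ord_recr [X in _ - _ * X]big_ord_recr /=.
rewrite [_ * (_ + saal_term _ _ _ _ M.+1 _)]mulrDr [_ * (_ + saal_term _ _ _ _ M _)]mulrDr.
rewrite opprD addrACA IHj.
rewrite /saal_term.
have -> : (M - j = l.+1)%N by lia.
have -> : (M.+1 - j.+1 = l.+1)%N by lia.
have -> : (M - j.+1 = l)%N by lia.
rewrite defM !qpochS !exprS !exprD ?exprS.
have h1 := hp l; have h2 := @qpoch_neq0 _ p p l hp.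
have h3 := hp j; have h4 := @qpoch_neq0 _ p p j hp.
have h5 := hc j; have h6 := @qpoch_neq0 _ (x * y * z) p j hc.
by field; rewrite h1 h2 h3 h4 h5 h6.
Qed.

Lemma saalschutz (F : fieldType) (p x y z : F) (M : nat) :
  p != 0 ->
  (forall i, 1 - p * p ^+ i != 0) -> (forall i, 1 - x * y * z * p ^+ i != 0) ->
  \sum_(i < M.+1) saal_term p x y z M i
  = qpoch (x * z) p M * qpoch (y * z) p M / (qpoch p p M * qpoch (x * y * z) p M).
Proof.
move=> p0 hp hc; elim: M => [|M IH].
  by rewrite big_ord1 /saal_term !qpoch0 expr0 !mulr1.
(* For j = M the certificate is minus the summand i = M+1 of the longer sum, times (1 - p^(M+1))(1 -
   xyz p^M). Hence the full sums satisfy the homogeneous recurrence of the product side. *)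
have := @saal_telescope _ p x y z M M p0 hp hc (leqnn M).
rewrite IH => h; rewrite big_ord_recr /=.
have h1 := hp M; have h2 := hc M.
apply: (mulfI (mulf_neq0 h1 h2)).
rewrite [LHS]mulrDr -exprS (canRL (subrK _) h) /saal_term !subnn !qpochS !qpoch0 exprS expr0.
have h3 := @qpoch_neq0 _ p p M hp; have h4 := @qpoch_neq0 _ (x * y * z) p M hc.
by rewrite ?exprS; field; rewrite h1 h2 h3 h4.
Qed.

Lemma sum_triangle (V : zmodType) (f : nat -> nat -> V) (N : nat) :
  \sum_(j < N.+1) \sum_(k < j.+1) f j k
  = \sum_(k < N.+1) \sum_(i < (N - k).+1) f (k + i)%N k.
Proof.
elim: N => [|N IH]; first by rewrite !big_ord1.
rewrite big_ord_recr IH [RHS]big_ord_recr /= subnn big_ord1 addn0.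
rewrite [\sum_(k < N.+2) f _ _]big_ord_recr /= addrA; congr (_ + _).
rewrite -big_split /=; apply: eq_bigr => k _.
have lekN : (k <= N)%N by rewrite -ltnS.
by rewrite subSn // [RHS]big_ord_recr /= addnS subnKC.
Qed.

(** Bailey's lemma, with the sequence beta written out as the inner sum over k. After exchanging the
    summations, the sum over j = k + i for fixed k is a q-Saalschuetz sum with x = d p^k, y = e p^k
    and z = ap/(de). *)
Lemma bailey_lemma (F : fieldType) (p a d e : F) (al : nat -> F) (N : nat) :
  p != 0 -> d != 0 -> e != 0 ->
  (forall i, 1 - p * p ^+ i != 0) -> (forall i, 1 - a * p * p ^+ i != 0) ->
  (forall i, 1 - a * p / d * p ^+ i != 0) ->
  (forall i, 1 - a * p / e * p ^+ i != 0) ->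
  \sum_(k < N.+1)
    qpoch d p k * qpoch e p k / (qpoch (a * p / d) p k * qpoch (a * p / e) p k)
    * (a * p / (d * e)) ^+ k
    * (al k / (qpoch p p (N - k) * qpoch (a * p) p (N + k)))
  = \sum_(j < N.+1)
      qpoch d p j * qpoch e p j * qpoch (a * p / (d * e)) p (N - j)
      * (a * p / (d * e)) ^+ j
      / (qpoch p p (N - j) * qpoch (a * p / d) p N * qpoch (a * p / e) p N)
      * \sum_(k < j.+1) al k / (qpoch p p (j - k) * qpoch (a * p) p (j + k)).
Proof.
move=> p0 d0 e0 hp ha hd he; set z := a * p / (d * e).
under [RHS]eq_bigr => j _ do rewrite mulr_sumr.
rewrite (sum_triangle _ (fun j k => qpoch d p j * qpoch e p j * qpoch z p (N - j) * z ^+ j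
      / (qpoch p p (N - j) * qpoch (a * p / d) p N * qpoch (a * p / e) p N)
      * (al k / (qpoch p p (j - k) * qpoch (a * p) p (j + k))))).
apply: eq_bigr => -[k /= ltkN] _.
have [M defN] : exists M, N = (k + M)%N by exists (N - k)%N; rewrite subnKC.
have zx : d * p ^+ k * z = a * p / e * p ^+ k by rewrite /z; field; rewrite ?d0 ?e0.
have zy : e * p ^+ k * z = a * p / d * p ^+ k by rewrite /z; field; rewrite ?d0 ?e0.
have zxy : d * p ^+ k * (e * p ^+ k) * z = a * p * p ^+ (k + k).
  by rewrite /z exprD; field; rewrite ?d0 ?e0.
have hxy i : 1 - d * p ^+ k * (e * p ^+ k) * z * p ^+ i != 0.
  by rewrite zxy -mulrA -exprD.
have := @saalschutz F p (d * p ^+ k) (e * p ^+ k) z M p0 hp hxy.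
have -> : (N - k = M)%N by rewrite defN addKn.
have nM := @qpoch_neq0 _ p p M hp.
have nk := @qpoch_neq0 _ (a * p) p (k + k) ha.
have nkM := @qpoch_neq0 _ (d * p ^+ k * (e * p ^+ k) * z) p M hxy.
have ndk := @qpoch_neq0 _ (a * p / d) p k hd.
have nek := @qpoch_neq0 _ (a * p / e) p k he.
have ndM : qpoch (a * p / d * p ^+ k) p M != 0.
  by apply: qpoch_neq0 => i; rewrite -mulrA -exprD.
have neM : qpoch (a * p / e * p ^+ k) p M != 0.
  by apply: qpoch_neq0 => i; rewrite -mulrA -exprD.
(* [C] collects the factors that do not depend on i. *)
set C := qpoch d p k * qpoch e p k * z ^+ k * al k
  / (qpoch (a * p / d) p N * qpoch (a * p / e) p N * qpoch (a * p) p (k + k)).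
move=> /(congr1 ( *%R C)); rewrite mulr_sumr zx zy => S.
transitivity (C * (qpoch (a * p / e * p ^+ k) p M * qpoch (a * p / d * p ^+ k) p M /
      (qpoch p p M * qpoch (d * p ^+ k * (e * p ^+ k) * z) p M))).
  have -> : (N + k = k + k + M)%N by rewrite defN addnAC.
  rewrite /C defN (qpochD _ (a * p) _ (k + k)).
  rewrite !(qpochD _ _ _ k M) -zxy.
  by field; rewrite ?nM ?nk ?nkM ?ndk ?nek ?ndM ?neM.
rewrite -S; apply: eq_bigr => -[i /= ltiM] _.
have [l defM] : exists l, M = (i + l)%N by exists (M - i)%N; rewrite subnKC.
rewrite /C /saal_term defN.
have -> : (M - i = l)%N by rewrite defM addKn.
have -> : (k + M - (k + i) = l)%N by rewrite subnDl defM addKn.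
have -> : (k + i - k = i)%N by rewrite addKn.
have -> : (k + i + k = k + k + i)%N by rewrite addnAC.
rewrite !(qpochD _ _ _ k M) !(qpochD _ _ _ k i) (qpochD _ _ _ (k + k) i) -zxy exprD.
have nl := @qpoch_neq0 _ p p l hp; have ni := @qpoch_neq0 _ p p i hp.
have nki := @qpoch_neq0 _ (d * p ^+ k * (e * p ^+ k) * z) p i hxy.
by field; rewrite ?nl ?ni ?nk ?nki ?ndk ?nek ?ndM ?neM.
Qed.

(** Bailey's lemma applied to this pair keeps a single term on the right. The partial sums are
    products, and the last term cancels the product reached just before it. *)
Lemma unit_bailey_pair (F : fieldType) (p a : F) (j : nat) :
  p != 0 -> 1 - a != 0 ->
  (forall i, 1 - p * p ^+ i != 0) -> (forall i, 1 - a * p * p ^+ i != 0) ->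
  \sum_(k < j.+1)
     ((1 - a * p ^+ (2 * k)) / (1 - a) * qpoch a p k / qpoch p p k
      * (-1) ^+ k * p ^+ 'C(k, 2)) / (qpoch p p (j - k) * qpoch (a * p) p (j + k))
  = (j == 0)%:R.
Proof.
move=> p0 a1 hp ha; case: j => [|j].
  by rewrite big_ord1 /= !qpoch0 muln0 !expr0; field; rewrite ?a1 ?oner_neq0.
have qa k : qpoch a p k.+1 = (1 - a) * qpoch (a * p) p k.
  by rewrite -add1n qpochD qpochS qpoch0 mul1r mulr1 expr1.
have np k := @qpoch_neq0 _ p p k hp.
have na k := @qpoch_neq0 _ (a * p) p k ha.
(* The index of the pair is j+1 here. The closed form has (p;p)_(j-m) in its denominator, so it
   stops at m = j and the term k = j+1 is added separately. *)
have part m : (m <= j)%N -> \sum_(k < m.+1)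
     ((1 - a * p ^+ (2 * k)) / (1 - a) * qpoch a p k / qpoch p p k
      * (-1) ^+ k * p ^+ 'C(k, 2)) / (qpoch p p (j.+1 - k) * qpoch (a * p) p (j.+1 + k))
  = (-1) ^+ m * p ^+ 'C(m.+1, 2) * qpoch (a * p) p m
    / (qpoch p p m * qpoch p p (j - m) * qpoch (a * p) p (j.+1 + m) * (1 - p * p ^+ j)).
  elim: m => [|m IH] lemj.
    rewrite big_ord1 subn0 addn0 !qpoch0 muln0 !expr0 subn0 qpochS.
    by field; rewrite ?np ?na ?hp ?ha ?a1 ?oner_neq0.
  rewrite big_ord_recr /= IH ?(ltnW lemj) //.
  have [l defj] : exists l, j = (m.+1 + l)%N by exists (j - m.+1)%N; rewrite subnKC.
  have -> : (j.+1 - m.+1 = l.+1)%N by lia.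
  have -> : (j - m.+1 = l)%N by lia.
  have -> : (j - m = l.+1)%N by lia.
  rewrite [(j.+1 + m.+1)%N]addnS.
  have h := ha (j.+1 + m)%N; have hj := hp j; have hm := hp m; have hl := hp l.
  have : p ^+ (j.+1 + m) = p ^+ 2 * p ^+ l * p ^+ m ^+ 2.
    by rewrite defj -exprM -!exprD; congr (_ ^+ _); lia.
  (* The exponent is made opaque so that its power of p can be rewritten through p^m and p^l before
     [field] runs. *)
  move: (j.+1 + m)%N h => t h pt.
  have pj : p ^+ j = p * p ^+ m * p ^+ l by rewrite defj exprD exprS.
  have -> : p ^+ (2 * m.+1) = p ^+ 2 * p ^+ m ^+ 2.
    by rewrite -exprM -exprD; congr (_ ^+ _); lia.
  have -> : p ^+ 'C(m.+2, 2) = p ^+ 'C(m.+1, 2) * (p * p ^+ m).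
    by rewrite [in LHS]binS bin1 exprD exprS.
  rewrite !qa !qpochS [(-1) ^+ m.+1]exprS; move: h hj; rewrite pt pj => h hj.
  by field; rewrite ?np ?na ?a1 ?h ?hj ?hm ?hl.
rewrite big_ord_recr /= part // !subnn.
rewrite -[RHS]/(0 : F).
rewrite [(j.+1 + j.+1)%N]addnS; have h := ha (j.+1 + j)%N.
have : p ^+ (j.+1 + j) = p * p ^+ j ^+ 2.
  by rewrite -exprM -exprS; congr (_ ^+ _); lia.
move: (j.+1 + j)%N h => t h pt; move: h.
have -> : p ^+ (2 * j.+1) = p ^+ 2 * p ^+ j ^+ 2.
  by rewrite -exprM -exprD; congr (_ ^+ _); lia.
rewrite !qa !qpochS qpoch0 [(-1) ^+ j.+1]exprS pt => h.
by field; rewrite ?np ?na ?a1 ?h ?hp.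
Qed.

(** Each factor 1 - x p^(i-N) equals -x p^(i-N) (1 - p^(N-i)/x). Denominators are cleared, so that
    nothing has to be assumed about the vanishing of (p/x;p)_(N-k). *)
Lemma qpoch_shift (F : fieldType) (p x : F) (N k : nat) :
  p != 0 -> x != 0 -> (k <= N)%N ->
  qpoch (x / p ^+ N) p k * p ^+ N ^+ k * qpoch (p / x) p (N - k)
  = (- x) ^+ k * p ^+ 'C(k, 2) * qpoch (p / x) p N.
Proof.
move=> p0 x0; elim: k => [|k IH] lekN.
  by rewrite qpoch0 !expr0 subn0 !mul1r.
have pN := expf_neq0 N p0; have pk := expf_neq0 k p0.
have -> : (- x) ^+ k.+1 * p ^+ 'C(k.+1, 2) * qpoch (p / x) p N
   = - x * p ^+ k * ((- x) ^+ k * p ^+ 'C(k, 2) * qpoch (p / x) p N).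
  by rewrite binS bin1 exprD exprS; ring.
rewrite -IH ?(ltnW lekN) // -(subnSK lekN) !qpochS !exprS.
have -> : p ^+ N = p ^+ (N - k.+1) * (p * p ^+ k).
  by rewrite -exprS -exprD subnK.
have pl := expf_neq0 (N - k.+1) p0.
by field; rewrite ?x0 ?p0 ?pk ?pl.
Qed.

(** Bailey's lemma applied twice to the unit pair, with b, c and then with d, e. The 4phi3 keeps its
    indices N - j, since its usual denominator (de p^-N/a;p)_j is (Y^2;p)_j in [lhs_at_u] and may
    vanish. *)
Lemma watson (F : fieldType) (p a b c d e : F) (N : nat) :
  p != 0 -> b != 0 -> c != 0 -> d != 0 -> e != 0 -> 1 - a != 0 ->
  (forall i, 1 - p * p ^+ i != 0) -> (forall i, 1 - a * p * p ^+ i != 0) ->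
  (forall i, 1 - a * p / b * p ^+ i != 0) ->
  (forall i, 1 - a * p / c * p ^+ i != 0) ->
  (forall i, 1 - a * p / d * p ^+ i != 0) ->
  (forall i, 1 - a * p / e * p ^+ i != 0) ->
  \sum_(k < N.+1)
    (1 - a * p ^+ (2 * k)) / (1 - a) * (qpoch a p k / qpoch p p k)
    * (qpoch b p k / qpoch (a * p / b) p k) * (qpoch c p k / qpoch (a * p / c) p k)
    * (qpoch d p k / qpoch (a * p / d) p k) * (qpoch e p k / qpoch (a * p / e) p k)
    * (qpoch (1 / p ^+ N) p k / qpoch (a * p * p ^+ N) p k)
    * (a ^+ 2 * p ^+ 2 * p ^+ N / (b * c * d * e)) ^+ k
  = qpoch p p N * qpoch (a * p) p N / (qpoch (a * p / d) p N * qpoch (a * p / e) p N)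
    * \sum_(j < N.+1)
        qpoch d p j * qpoch e p j * qpoch (a * p / (d * e)) p (N - j)
        * (a * p / (d * e)) ^+ j * qpoch (a * p / (b * c)) p j
        / (qpoch p p (N - j) * qpoch p p j
           * qpoch (a * p / b) p j * qpoch (a * p / c) p j).
Proof.
move=> p0 b0 c0 d0 e0 a1 hp ha hb hc hd he.
pose al0 k := (1 - a * p ^+ (2 * k)) / (1 - a) * qpoch a p k / qpoch p p k
      * (-1) ^+ k * p ^+ 'C(k, 2).
pose al k := qpoch b p k * qpoch c p k / (qpoch (a * p / b) p k * qpoch (a * p / c) p k)
    * (a * p / (b * c)) ^+ k * al0 k.
have np k := @qpoch_neq0 _ p p k hp; have na k := @qpoch_neq0 _ (a * p) p k ha.
have nb k := @qpoch_neq0 _ _ p k hb; have nc k := @qpoch_neq0 _ _ p k hc.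
have nd k := @qpoch_neq0 _ _ p k hd; have ne k := @qpoch_neq0 _ _ p k he.
have inner j : \sum_(k < j.+1) al k / (qpoch p p (j - k) * qpoch (a * p) p (j + k))
   = qpoch (a * p / (b * c)) p j
     / (qpoch p p j * qpoch (a * p / b) p j * qpoch (a * p / c) p j).
  have := @bailey_lemma F p a b c al0 j p0 b0 c0 hp ha hb hc.
  under [LHS]eq_bigr => k _ do rewrite mulrA -/(al k).
  move=> ->; under eq_bigr => k _ do rewrite unit_bailey_pair //.
  (* Only the index 0 of the outer sum survives the unit pair. *)
  rewrite big_ord_recl big1 => [|k _]; last by rewrite mulr0.
  by rewrite !qpoch0 !expr0 subn0 eqxx !mulr1 !mul1r addr0.
have := @bailey_lemma F p a d e al N p0 d0 e0 hp ha hd he.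
under [in RHS]eq_bigr => j _ do rewrite inner.
(* This factor turns 1/((p;p)_(N-k) (ap;p)_(N+k)) into the terminating pair
   (p^-N;p)_k/(ap^(N+1);p)_k, up to a sign and powers of p. *)
move=> /(congr1 ( *%R (qpoch p p N * qpoch (a * p) p N))) E.
transitivity (\sum_(k < N.+1) qpoch p p N * qpoch (a * p) p N *
  (qpoch d p k * qpoch e p k / (qpoch (a * p / d) p k * qpoch (a * p / e) p k) *
         (a * p / (d * e)) ^+ k *
         (al k / (qpoch p p (N - k) * qpoch (a * p) p (N + k))))).
  apply: eq_bigr => -[k /=]; rewrite ltnS => lekN _.
  rewrite (qpochD _ (a * p) _ N k).
  have naN : qpoch (a * p * p ^+ N) p k != 0.
    by apply: qpoch_neq0 => i; rewrite -mulrA -exprD.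
  have pN := expf_neq0 N p0.
  have pNk : p ^+ N ^+ k != 0 by rewrite expf_neq0.
  have := @qpoch_shift F p 1 N k p0 (oner_neq0 _) lekN.
  rewrite divr1 => h.
  have -> : qpoch (1 / p ^+ N) p k
     = (-1) ^+ k * p ^+ 'C(k, 2) * qpoch p p N / (p ^+ N ^+ k * qpoch p p (N - k)).
    by rewrite -h; field; rewrite ?np ?pNk ?pN.
  rewrite /al /al0.
  have -> : a ^+ 2 * p ^+ 2 * p ^+ N / (b * c * d * e)
     = a * p / (b * c) * (a * p / (d * e)) * p ^+ N.
    by field; rewrite ?b0 ?c0 ?d0 ?e0.
  rewrite [(_ * p ^+ N) ^+ k]exprMn [(_ * (a * p / (d * e))) ^+ k]exprMn.
  by field; rewrite ?np ?na ?nb ?nc ?nd ?ne ?naN ?pNk ?a1 ?pN.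
rewrite -mulr_sumr E 2!mulr_sumr; apply: eq_bigr => j _.
by field; rewrite ?np ?nb ?nc ?nd ?ne.
Qed.

(** * Congruences over a subring of a field *)

(** Membership is a [Prop], because for the localization it is the mere existence of a suitable
    fraction. *)
Record subring_pred (F : fieldType) := SubringPred {
  in_subring :> F -> Prop;
  in_subring1 : in_subring 1;
  in_subringB : forall x y, in_subring x -> in_subring y -> in_subring (x - y);
  in_subringM : forall x y, in_subring x -> in_subring y -> in_subring (x * y)
}.

Definition unit_in (F : fieldType) (R : subring_pred F) (x : F) : Prop :=
  [/\ x != 0, R x & R x^-1].
Arguments unit_in {F} R x.

(** Membership of both sides belongs to the congruence: without it congruences could not be
    multiplied. *)
Definition eqmod_in (F : fieldType) (R : subring_pred F) (m x y : F) : Prop :=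
  [/\ R x, R y & exists2 z, R z & x - y = m * z].
Arguments eqmod_in {F} R m x y.

Lemma in_subring0 (F : fieldType) (R : subring_pred F) : R 0.
Proof. by rewrite -(subrr 1); apply: in_subringB; apply: in_subring1. Qed.

Lemma in_subringN (F : fieldType) (R : subring_pred F) x : R x -> R (- x).
Proof. by move=> Rx; rewrite -sub0r; apply: in_subringB => //; apply: in_subring0. Qed.

Lemma in_subringD (F : fieldType) (R : subring_pred F) x y : R x -> R y -> R (x + y).
Proof. by move=> Rx Ry; rewrite -[y]opprK; apply: in_subringB => //; apply: in_subringN. Qed.

Lemma in_subringX (F : fieldType) (R : subring_pred F) x n : R x -> R (x ^+ n).
Proof.
move=> Rx; elim: n => [|n IH]; first exact: in_subring1.
by rewrite exprS; apply: in_subringM.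
Qed.

Lemma in_subring_qpoch (F : fieldType) (R : subring_pred F) x y n :
  R x -> R y -> R (qpoch x y n).
Proof.
move=> Rx Ry; elim: n => [|n IH]; first by rewrite qpoch0; apply: in_subring1.
rewrite qpochS; apply: in_subringM => //; apply: in_subringB; first exact: in_subring1.
by apply: in_subringM => //; apply: in_subringX.
Qed.

Lemma in_subring_sum (F : fieldType) (R : subring_pred F) n (f : nat -> F) :
  (forall i, (i < n)%N -> R (f i)) -> R (\sum_(i < n) f i).
Proof.
move=> h; elim/big_ind: _ => [|x y|i _]; [exact: in_subring0|exact: in_subringD|exact: h].
Qed.

Lemma unit_in1 (F : fieldType) (R : subring_pred F) : unit_in R 1.
Proof. by split; rewrite ?invr1 ?oner_neq0 //; apply: in_subring1. Qed.

Lemma unit_inM (F : fieldType) (R : subring_pred F) x y :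
  unit_in R x -> unit_in R y -> unit_in R (x * y).
Proof.
move=> [x0 Rx RVx] [y0 Ry RVy]; split; first by rewrite mulf_neq0.
  exact: in_subringM.
by rewrite invfM; apply: in_subringM.
Qed.

Lemma unit_inV (F : fieldType) (R : subring_pred F) x :
  unit_in R x -> unit_in R x^-1.
Proof. by move=> [x0 Rx RVx]; split; rewrite ?invr_eq0 ?invrK. Qed.

Lemma unit_inX (F : fieldType) (R : subring_pred F) x n :
  unit_in R x -> unit_in R (x ^+ n).
Proof.
move=> ux; elim: n => [|n IH]; first exact: unit_in1.
by rewrite exprS; apply: unit_inM.
Qed.

Lemma unit_in_qpoch (F : fieldType) (R : subring_pred F) x y n :
  (forall i, (i < n)%N -> unit_in R (1 - x * y ^+ i)) -> unit_in R (qpoch x y n).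
Proof.
elim: n => [|n IH] h; first by rewrite qpoch0; apply: unit_in1.
by rewrite qpochS; apply: unit_inM; [apply: IH => i lt_in; apply: h; apply: ltnW|apply: h].
Qed.

Lemma eqmod_refl (F : fieldType) (R : subring_pred F) m x : R x -> eqmod_in R m x x.
Proof. by split=> //; exists 0; rewrite ?subrr ?mulr0 //; apply: in_subring0. Qed.

Lemma eqmod_sym (F : fieldType) (R : subring_pred F) m x y :
  eqmod_in R m x y -> eqmod_in R m y x.
Proof.
move=> [Rx Ry [z Rz E]]; split=> //; exists (- z); first exact: in_subringN.
by rewrite mulrN -E opprB.
Qed.

Lemma eqmod_trans (F : fieldType) (R : subring_pred F) m y x z :
  eqmod_in R m x y -> eqmod_in R m y z -> eqmod_in R m x z.
Proof.
move=> [Rx Ry [s Rs E]] [_ Rz [t Rt E']]; split=> //.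
exists (s + t); first exact: in_subringD.
by rewrite mulrDr -E -E'; ring.
Qed.

Lemma eqmodD (F : fieldType) (R : subring_pred F) m x y x' y' :
  eqmod_in R m x y -> eqmod_in R m x' y' -> eqmod_in R m (x + x') (y + y').
Proof.
move=> [Rx Ry [s Rs E]] [Rx' Ry' [t Rt E']]; split; try exact: in_subringD.
exists (s + t); first exact: in_subringD.
by rewrite mulrDr -E -E'; ring.
Qed.

Lemma eqmodM (F : fieldType) (R : subring_pred F) m x y x' y' :
  eqmod_in R m x y -> eqmod_in R m x' y' -> eqmod_in R m (x * x') (y * y').
Proof.
move=> [Rx Ry [s Rs E]] [Rx' Ry' [t Rt E']]; split; try exact: in_subringM.
exists (s * x' + y * t); first by apply: in_subringD; apply: in_subringM.
have -> : x * x' - y * y' = (x - y) * x' + y * (x' - y') by ring.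
by rewrite E E'; ring.
Qed.

Lemma eqmodN (F : fieldType) (R : subring_pred F) m x y :
  eqmod_in R m x y -> eqmod_in R m (- x) (- y).
Proof.
move=> [Rx Ry [s Rs E]]; split; try exact: in_subringN.
by exists (- s); [apply: in_subringN|rewrite mulrN -E; ring].
Qed.

Lemma eqmodB (F : fieldType) (R : subring_pred F) m x y x' y' :
  eqmod_in R m x y -> eqmod_in R m x' y' -> eqmod_in R m (x - x') (y - y').
Proof. by move=> h h'; apply: eqmodD => //; apply: eqmodN. Qed.

Lemma eqmodX (F : fieldType) (R : subring_pred F) m x y n :
  eqmod_in R m x y -> eqmod_in R m (x ^+ n) (y ^+ n).
Proof.
move=> h; elim: n => [|n IH]; first by apply: eqmod_refl; apply: in_subring1.
by rewrite !exprS; apply: eqmodM.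
Qed.

Lemma eqmodV (F : fieldType) (R : subring_pred F) m x y :
  unit_in R x -> unit_in R y -> eqmod_in R m x y -> eqmod_in R m x^-1 y^-1.
Proof.
move=> [x0 _ RVx] [y0 _ RVy] [_ _ [z Rz E]]; split=> //.
exists (- (z * x^-1 * y^-1)).
  by apply: in_subringN; do 2!apply: in_subringM => //.
have -> : x^-1 - y^-1 = - ((x - y) * x^-1 * y^-1) by field; rewrite ?x0 ?y0.
by rewrite E; ring.
Qed.

Lemma eqmod_qpoch (F : fieldType) (R : subring_pred F) m x x' y n :
  R y -> eqmod_in R m x x' -> eqmod_in R m (qpoch x y n) (qpoch x' y n).
Proof.
move=> Ry h; have h1 := @eqmod_refl _ R m _ (in_subring1 _ R).
elim: n => [|n IH]; first by rewrite !qpoch0.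
rewrite !qpochS; apply: eqmodM => //; apply: eqmodB => //; apply: eqmodM => //.
by apply: eqmod_refl; apply: in_subringX.
Qed.

Lemma eqmod_sum (F : fieldType) (R : subring_pred F) m n (f g : nat -> F) :
  (forall i, (i < n)%N -> eqmod_in R m (f i) (g i)) ->
  eqmod_in R m (\sum_(i < n) f i) (\sum_(i < n) g i).
Proof.
elim: n => [|n IH] h.
  by rewrite !big_ord0; apply: eqmod_refl; apply: in_subring0.
rewrite !big_ord_recr /=; apply: eqmodD; last exact: h.
by apply: IH => i lt_in; apply: h; apply: ltnW.
Qed.

(** A common factor 1 - u, divisible by Phi_n(q), upgrades a congruence modulo Phi_n(q) to one
    modulo its square. *)
Lemma eqmod_lift (F : fieldType) (R : subring_pred F) m m' h x y :
  R h -> (exists2 z, R z & h = m' * z) -> eqmod_in R m x y ->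
  eqmod_in R (m' * m) (h * x) (h * y).
Proof.
move=> Rh [z Rz hz] [Rx Ry [t Rt E]]; split; try exact: in_subringM.
by exists (z * t); [apply: in_subringM|rewrite -mulrBr E hz; ring].
Qed.

(** * The two congruences for the hypergeometric sums *)

(** In the application p = q^d, Y = q^r and w = 1 - q. The last is a separate parameter because q is
    Y or 1/Y according to the sign of r. *)
Definition lhs_term (F : fieldType) (p Y a c e w : F) (k : nat) : F :=
  (1 - Y * p ^+ (2 * k)) / w *
  (qpoch Y p k ^+ 2 * qpoch (c * Y) p k * qpoch (e * Y) p k
     * qpoch (a * Y) p k * qpoch (Y / a) p k)
  / (qpoch p p k ^+ 2 * qpoch (p / c) p k * qpoch (p / e) p k
     * qpoch (p / a) p k * qpoch (a * p) p k)
  * (p ^+ 2 / Y ^+ 3 / (c * e)) ^+ k.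
Arguments lhs_term {F} p Y a c e w k.

Definition rhs_term (F : fieldType) (p Y a c e : F) (N k : nat) : F :=
  (qpoch (Y ^+ 2 * p ^+ k) p (N - k)
     * qpoch (p / Y / (c * e)) p k * qpoch (a * Y) p k
     * qpoch (Y / a) p k * qpoch Y p k)
  / (qpoch p p k * qpoch (p / c) p k * qpoch (p / e) p k)
  * p ^+ k.
Arguments rhs_term {F} p Y a c e N k.

Definition twisted_term (F : fieldType) (p Y u a c e w : F) (N k : nat) : F :=
  (1 - Y * p ^+ (2 * k)) / w *
  (qpoch Y p k * (u ^+ k * qpoch (1 / p ^+ N) p k)
     * qpoch (c * Y) p k * qpoch (e * Y) p k * qpoch (a * Y) p k * qpoch (Y / a) p k)
  / (qpoch p p k * qpoch (p * u) p k * qpoch (p / c) p k * qpoch (p / e) p k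
     * qpoch (p / a) p k * qpoch (a * p) p k)
  * (p ^+ 2 / Y ^+ 3 / (c * e)) ^+ k.
Arguments twisted_term {F} p Y u a c e w N k.

Lemma bin2_double n : (2 * 'C(n, 2) + n = n * n)%N.
Proof. by elim: n => // n IH; rewrite binS bin1; nia. Qed.

(* Used twice: as it stands, for the terms of Watson's formula at a = u, and read
   modulo Phi_n(q), where Y = p^-N, for the terms of the twisted sum. *)
Lemma reversal_identity (F : fieldType) (p Y : F) (N j : nat) :
  p != 0 -> Y != 0 -> (j <= N)%N ->
  qpoch Y p N * qpoch (p / (Y ^+ 2 * p ^+ N)) p (N - j)
    * (p / (Y ^+ 2 * p ^+ N)) ^+ j * qpoch p p N
  = Y ^- N * qpoch (p / (Y * p ^+ N)) p N * qpoch p p (N - j)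
    * qpoch (Y ^+ 2 * p ^+ j) p (N - j) * qpoch (1 / p ^+ N) p j * p ^+ j.
Proof.
move=> p0 Y0 lejN.
have [l defN] : exists l, N = (j + l)%N by exists (N - j)%N; rewrite subnKC.
have -> : (N - j = l)%N by lia.
have nX (x : F) i : x != 0 -> x ^+ i != 0 := fun x0 => expf_neq0 i x0.
have := @qpoch_shift F p (p / Y) N N p0 (mulf_neq0 p0 (invr_neq0 Y0)) (leqnn N).
have -> : p / (p / Y) = Y by field; rewrite ?p0 ?Y0.
have -> : p / Y / p ^+ N = p / (Y * p ^+ N) by field; rewrite ?nX ?p0 ?Y0.
have Y2 : Y ^+ 2 * p ^+ j != 0 by rewrite mulf_neq0 ?nX.
have := @qpoch_shift F p (p / (Y ^+ 2 * p ^+ j)) l l p0 (mulf_neq0 p0 (invr_neq0 Y2)) (leqnn l).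
have -> : p / (p / (Y ^+ 2 * p ^+ j)) = Y ^+ 2 * p ^+ j by field; rewrite ?nX ?p0 ?Y0.
have -> : p / (Y ^+ 2 * p ^+ j) / p ^+ l = p / (Y ^+ 2 * p ^+ N).
  by rewrite defN exprD; field; rewrite ?nX ?p0 ?Y0.
have := @qpoch_shift F p 1 N j p0 (oner_neq0 _) lejN.
have -> : (N - j = l)%N by lia.
rewrite !divr1 !subnn !qpoch0 !mulr1.
move: (qpoch (1 / p ^+ N) p j) (qpoch (p / (Y ^+ 2 * p ^+ N)) p l)
  (qpoch (p / (Y * p ^+ N)) p N) => A B C hA hB hC.
have hA' : A * qpoch p p l = (-1) ^+ j * p ^+ 'C(j, 2) * qpoch p p N / p ^+ N ^+ j.
  by rewrite -hA; field; rewrite ?nX.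
have hB' : B = (- (p / (Y ^+ 2 * p ^+ j))) ^+ l * p ^+ 'C(l, 2) *
     qpoch (Y ^+ 2 * p ^+ j) p l / p ^+ l ^+ l.
  by rewrite -hB; field; rewrite ?nX.
have hC' : C = (- (p / Y)) ^+ N * p ^+ 'C(N, 2) * qpoch Y p N / p ^+ N ^+ N.
  by rewrite -hC; field; rewrite ?nX.
have -> : Y ^- N * C * qpoch p p l * qpoch (Y ^+ 2 * p ^+ j) p l * A * p ^+ j
  = Y ^- N * C * (A * qpoch p p l) * qpoch (Y ^+ 2 * p ^+ j) p l * p ^+ j by ring.
rewrite hA' hB' hC'.
have bj := bin2_double j; have bl := bin2_double l.
have cN : 'C(N, 2) = ('C(j, 2) + 'C(l, 2) + j * l)%N.
  by have := bin2_double N; rewrite defN; nia.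
have jj : p ^+ j ^+ j = p ^+ 'C(j, 2) ^+ 2 * p ^+ j.
  by rewrite -!exprM -exprD; congr (_ ^+ _); lia.
have lj : p ^+ l ^+ j = p ^+ j ^+ l by rewrite -!exprM mulnC.
have sj : (-1) ^+ j = ((-1) ^+ j)^-1 :> F by rewrite -exprVn invrN1.
have sj0 : (-1) ^+ j != 0 :> F by rewrite signr_eq0.
have e1 : (- (p / (Y ^+ 2 * p ^+ j))) ^+ l = (-1) ^+ l * p ^+ l / (Y ^+ l ^+ 2 * p ^+ j ^+ l).
  by rewrite [in LHS]exprNn expr_div_n exprMn [Y ^+ 2 ^+ l]exprAC mulrA.
have e2 : (p / (Y ^+ 2 * p ^+ N)) ^+ j = p ^+ j / (Y ^+ j ^+ 2 * (p ^+ j ^+ j * p ^+ j ^+ l)).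
  by rewrite expr_div_n exprMn [Y ^+ 2 ^+ j]exprAC defN exprD exprMn lj.
have e3 : (- (p / Y)) ^+ N = (-1) ^+ l / (-1) ^+ j * (p ^+ j * p ^+ l) / (Y ^+ j * Y ^+ l).
  by rewrite [in LHS]exprNn expr_div_n defN !exprD [in LHS]sj; field; rewrite ?sj0 ?nX ?Y0.
have e4 : p ^+ N ^+ N = p ^+ j ^+ j * p ^+ j ^+ l ^+ 2 * p ^+ l ^+ l.
  by rewrite -!exprM -!exprD; congr (_ ^+ _); rewrite defN; lia.
have e5 : p ^+ N ^+ j = p ^+ j ^+ j * p ^+ j ^+ l.
  by rewrite defN exprD exprMn lj.
rewrite e1 e2 e3 e4 e5 cN jj !(exprD p) (exprM p j l) defN !(exprD Y) -defN.
by field; rewrite ?sj0 ?nX ?p0 ?Y0.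
Qed.

(** Two kinds of hypotheses concern similar factors. Watson's formula is an identity in the field
    and needs them nonzero for every i; the congruences need units of R, and the factors free of a,
    c, e are units only in the range i < N, as later ones may be divisible by Phi_n(q). *)
Record admissible (F : fieldType) (R : subring_pred F) (phi p Y u a c e w : F)
    (N : nat) : Prop := Admissible {
  adm_phi : R phi;
  adm_p : unit_in R p; adm_Y : unit_in R Y; adm_a : unit_in R a;
  adm_c : unit_in R c; adm_e : unit_in R e; adm_w : unit_in R w;
  adm_1a : unit_in R (1 - a);
  adm_two : 2%:R != 0 :> F;
  adm_nY : forall i, 1 - Y * p ^+ i != 0;
  adm_np : forall i, 1 - p * p ^+ i != 0;
  adm_npVu : forall i, 1 - p / u * p ^+ i != 0;
  adm_1p : forall i, (i < N)%N -> unit_in R (1 - p * p ^+ i);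
  adm_1pu : forall i, (i < N)%N -> unit_in R (1 - p * u * p ^+ i);
  adm_1pVu : forall i, (i < N)%N -> unit_in R (1 - p / u * p ^+ i);
  adm_1pc : forall i, unit_in R (1 - p / c * p ^+ i);
  adm_1pe : forall i, unit_in R (1 - p / e * p ^+ i);
  adm_1pVa : forall i, unit_in R (1 - p / a * p ^+ i);
  adm_1pa : forall i, unit_in R (1 - a * p * p ^+ i);
  adm_u : u = Y * p ^+ N;
  adm_dvd : exists2 z, R z & 1 - u = phi * z
}.
Arguments admissible {F} R phi p Y u a c e w N.
Arguments adm_phi {F R phi p Y u a c e w N}.
Arguments adm_p {F R phi p Y u a c e w N}.
Arguments adm_Y {F R phi p Y u a c e w N}.
Arguments adm_a {F R phi p Y u a c e w N}.
Arguments adm_c {F R phi p Y u a c e w N}.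
Arguments adm_e {F R phi p Y u a c e w N}.
Arguments adm_w {F R phi p Y u a c e w N}.
Arguments adm_1a {F R phi p Y u a c e w N}.
Arguments adm_two {F R phi p Y u a c e w N}.
Arguments adm_nY {F R phi p Y u a c e w N}.
Arguments adm_np {F R phi p Y u a c e w N}.
Arguments adm_npVu {F R phi p Y u a c e w N}.
Arguments adm_1p {F R phi p Y u a c e w N}.
Arguments adm_1pu {F R phi p Y u a c e w N}.
Arguments adm_1pVu {F R phi p Y u a c e w N}.
Arguments adm_1pc {F R phi p Y u a c e w N}.
Arguments adm_1pe {F R phi p Y u a c e w N}.
Arguments adm_1pVa {F R phi p Y u a c e w N}.
Arguments adm_1pa {F R phi p Y u a c e w N}.
Arguments adm_u {F R phi p Y u a c e w N}.
Arguments adm_dvd {F R phi p Y u a c e w N}.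

Lemma lhs_at_u (F : fieldType) (R : subring_pred F) phi p Y u a c e w N :
  admissible R phi p Y u a c e w N ->
  \sum_(k < N.+1) lhs_term p Y u c e w k
  = (1 - u) / w * (Y ^- N / qpoch p p N) * \sum_(k < N.+1) rhs_term p Y u c e N k.
Proof.
move=> H.
have [p0 _ _] := adm_p H; have [Y0 _ _] := adm_Y H; have [c0 _ _] := adm_c H.
have [e0 _ _] := adm_e H; have [w0 _ _] := adm_w H.
have hY := adm_nY H; have hp := adm_np H; have hu := adm_npVu H; have defu := adm_u H.
have pN0 : p ^+ N != 0 by rewrite expf_neq0.
have u0 : u != 0 by rewrite defu mulf_neq0.
have Y1 : 1 - Y != 0 by have := hY 0%N; rewrite mulr1.
have E1 : Y * p / (c * Y) = p / c by field; rewrite ?c0 ?Y0.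
have E2 : Y * p / (e * Y) = p / e by field; rewrite ?e0 ?Y0.
have E3 : Y * p / Y = p by field.
have E4 : Y * p / (u * Y) = p / u by field; rewrite ?u0 ?Y0.
have hc i : 1 - Y * p / (c * Y) * p ^+ i != 0 by rewrite E1; case: (adm_1pc H i).
have he i : 1 - Y * p / (e * Y) * p ^+ i != 0 by rewrite E2; case: (adm_1pe H i).
have hY' i : 1 - Y * p * p ^+ i != 0 by rewrite -mulrA -exprS.
have hpY i : 1 - Y * p / Y * p ^+ i != 0 by rewrite E3.
have hpu i : 1 - Y * p / (u * Y) * p ^+ i != 0 by rewrite E4.
(* One of the two factors (Y;p)_k/(p;p)_k is the very-well-poised one, the other comes from the
   parameter d = Y. For a = u the pair (Y/a;p)_k/(ap;p)_k is the terminating one. *)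
have := @watson F p Y (c * Y) (e * Y) Y (u * Y) N p0 (mulf_neq0 c0 Y0) (mulf_neq0 e0 Y0)
  Y0 (mulf_neq0 u0 Y0) Y1 hp hY' hc he hpY hpu.
rewrite E1 E2 E3 E4.
have -> : Y ^+ 2 * p ^+ 2 * p ^+ N / (c * Y * (e * Y) * Y * (u * Y)) = p ^+ 2 / Y ^+ 3 / (c * e).
  by rewrite defu; field; rewrite ?p0 ?Y0 ?c0 ?e0 ?pN0.
have -> : Y * p / (Y * (u * Y)) = p / (Y ^+ 2 * p ^+ N).
  by rewrite defu; field; rewrite ?p0 ?Y0 ?c0 ?e0 ?pN0.
have -> : Y * p / (c * Y * (e * Y)) = p / Y / (c * e).
  by field; rewrite ?p0 ?Y0 ?c0 ?e0 ?pN0.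
move=> /(congr1 ( *%R ((1 - Y) / w))) E.
have np k := @qpoch_neq0 _ p p k hp.
have nc k : qpoch (p / c) p k != 0 by apply: qpoch_neq0 => i; rewrite -E1.
have ne k : qpoch (p / e) p k != 0 by apply: qpoch_neq0 => i; rewrite -E2.
have nu k : qpoch (p / u) p k != 0 by apply: qpoch_neq0.
have npu k : qpoch (Y * p * p ^+ N) p k != 0.
  by apply: qpoch_neq0 => i; rewrite -mulrA -exprD.
transitivity ((1 - Y) / w * \sum_(k < N.+1)
  (1 - Y * p ^+ (2 * k)) / (1 - Y) * (qpoch Y p k / qpoch p p k) *
  (qpoch (c * Y) p k / qpoch (p / c) p k) * (qpoch (e * Y) p k / qpoch (p / e) p k) *
  (qpoch Y p k / qpoch p p k) * (qpoch (u * Y) p k / qpoch (p / u) p k) *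
  (qpoch (1 / p ^+ N) p k / qpoch (Y * p * p ^+ N) p k) *
  (p ^+ 2 / Y ^+ 3 / (c * e)) ^+ k).
  rewrite mulr_sumr; apply: eq_bigr => k _; rewrite /lhs_term.
  have -> : Y / u = 1 / p ^+ N by rewrite defu; field; rewrite ?Y0 ?pN0.
  have -> : u * p = Y * p * p ^+ N by rewrite defu; ring.
  move: (_ ^+ k) => zk.
  by field; rewrite ?np ?nc ?ne ?nu ?npu ?Y1 ?w0.
rewrite E 3!mulr_sumr; apply: eq_bigr => -[k /=]; rewrite ltnS => lekN _.
have := @reversal_identity F p Y N k p0 Y0 lekN.
have -> : p / (Y * p ^+ N) = p / u by rewrite defu.
rewrite /rhs_term.
have -> : Y / u = 1 / p ^+ N by rewrite defu; field; rewrite ?Y0 ?pN0.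
(* Both sides are (Y;p)_(N+1); this is the source of the factor 1 - u in the closed form. *)
have qY : (1 - u) * qpoch Y p N = (1 - Y) * qpoch (Y * p) p N.
  by rewrite defu mulrC -qpochS -add1n qpochD qpochS qpoch0 expr0 expr1 mul1r mulr1.
move: (p / (Y ^+ 2 * p ^+ N)) => x.
move: (qpoch x p (N - k)) (x ^+ k) => A B rev.
have -> : (1 - Y) / w * (qpoch p p N * qpoch (Y * p) p N / (qpoch p p N * qpoch (p / u) p N) *
   (qpoch Y p k * qpoch (u * Y) p k * A * B * qpoch (p / Y / (c * e)) p k /
    (qpoch p p (N - k) * qpoch p p k * qpoch (p / c) p k * qpoch (p / e) p k)))
  = ((1 - Y) * qpoch (Y * p) p N) / w / qpoch (p / u) p N * A * B *
    (qpoch Y p k * qpoch (u * Y) p k * qpoch (p / Y / (c * e)) p k /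
    (qpoch p p (N - k) * qpoch p p k * qpoch (p / c) p k * qpoch (p / e) p k)).
  by field; rewrite ?np ?nc ?ne ?nu ?w0.
rewrite -qY.
have -> : (1 - u) * qpoch Y p N / w / qpoch (p / u) p N * A * B
  = (1 - u) / w / (qpoch (p / u) p N * qpoch p p N) * (qpoch Y p N * A * B * qpoch p p N).
  by field; rewrite ?np ?nc ?ne ?nu ?w0.
rewrite rev; have YN : Y ^+ N != 0 by rewrite expf_neq0.
by field; rewrite ?np ?nc ?ne ?nu ?w0 ?YN.
Qed.

Lemma twisted_sum (F : fieldType) (R : subring_pred F) phi p Y u a c e w N :
  admissible R phi p Y u a c e w N ->
  \sum_(k < N.+1) twisted_term p Y u a c e w N k
  = (1 - u) / w * (qpoch p p N / (qpoch (p / a) p N * qpoch (a * p) p N))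
    * \sum_(k < N.+1)
        qpoch Y p N * qpoch (p / Y) p (N - k) * (p / Y) ^+ k / qpoch p p (N - k)
        * (qpoch (p / Y / (c * e)) p k * qpoch (a * Y) p k * qpoch (Y / a) p k
           / (qpoch p p k * qpoch (p / c) p k * qpoch (p / e) p k)).
Proof.
move=> H.
have [p0 _ _] := adm_p H; have [Y0 _ _] := adm_Y H; have [c0 _ _] := adm_c H.
have [e0 _ _] := adm_e H; have [w0 _ _] := adm_w H; have [a0 _ _] := adm_a H.
have hY := adm_nY H; have hp := adm_np H; have defu := adm_u H.
have pN0 : p ^+ N != 0 by rewrite expf_neq0.
have Y1 : 1 - Y != 0 by have := hY 0%N; rewrite mulr1.
have E1 : Y * p / (c * Y) = p / c by field; rewrite ?c0 ?Y0.
have E2 : Y * p / (e * Y) = p / e by field; rewrite ?e0 ?Y0.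
have E3 : Y * p / (a * Y) = p / a by field; rewrite ?a0 ?Y0.
have E4 : Y * p / (Y / a) = a * p by field; rewrite ?a0 ?Y0.
have hc i : 1 - Y * p / (c * Y) * p ^+ i != 0 by rewrite E1; case: (adm_1pc H i).
have he i : 1 - Y * p / (e * Y) * p ^+ i != 0 by rewrite E2; case: (adm_1pe H i).
have hY' i : 1 - Y * p * p ^+ i != 0 by rewrite -mulrA -exprS.
have haY i : 1 - Y * p / (a * Y) * p ^+ i != 0 by rewrite E3; case: (adm_1pVa H i).
have hYa i : 1 - Y * p / (Y / a) * p ^+ i != 0 by rewrite E4; case: (adm_1pa H i).
have := @watson F p Y (c * Y) (e * Y) (a * Y) (Y / a) N p0 (mulf_neq0 c0 Y0) (mulf_neq0 e0 Y0)
  (mulf_neq0 a0 Y0) (mulf_neq0 Y0 (invr_neq0 a0)) Y1 hp hY' hc he haY hYa.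
rewrite E1 E2 E3 E4.
have -> : Y ^+ 2 * p ^+ 2 * p ^+ N / (c * Y * (e * Y) * (a * Y) * (Y / a))
   = u * (p ^+ 2 / Y ^+ 3 / (c * e)).
  by rewrite defu; field; rewrite ?p0 ?Y0 ?c0 ?e0 ?a0 ?pN0.
have -> : Y * p / (a * Y * (Y / a)) = p / Y by field; rewrite ?a0 ?Y0.
have -> : Y * p / (c * Y * (e * Y)) = p / Y / (c * e).
  by field; rewrite ?p0 ?Y0 ?c0 ?e0 ?pN0.
have -> : Y * p * p ^+ N = p * u by rewrite defu; ring.
move=> /(congr1 ( *%R ((1 - Y) / w))) E.
have np k := @qpoch_neq0 _ p p k hp.
have nc k : qpoch (p / c) p k != 0 by apply: qpoch_neq0 => i; rewrite -E1.
have ne k : qpoch (p / e) p k != 0 by apply: qpoch_neq0 => i; rewrite -E2.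
have na k : qpoch (p / a) p k != 0 by apply: qpoch_neq0 => i; rewrite -E3.
have na' k : qpoch (a * p) p k != 0 by apply: qpoch_neq0 => i; rewrite -E4.
have npu k : qpoch (p * u) p k != 0.
  apply: qpoch_neq0 => i; rewrite defu.
  have -> : p * (Y * p ^+ N) * p ^+ i = Y * p ^+ (N + i).+1 by rewrite exprS exprD; ring.
  exact: hY.
have qY : (1 - u) * qpoch Y p N = (1 - Y) * qpoch (Y * p) p N.
  by rewrite defu mulrC -qpochS -add1n qpochD qpochS qpoch0 expr0 expr1 mul1r mulr1.
transitivity ((1 - Y) / w * \sum_(k < N.+1)
  (1 - Y * p ^+ (2 * k)) / (1 - Y) * (qpoch Y p k / qpoch p p k) *
  (qpoch (c * Y) p k / qpoch (p / c) p k) * (qpoch (e * Y) p k / qpoch (p / e) p k) *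
  (qpoch (a * Y) p k / qpoch (p / a) p k) * (qpoch (Y / a) p k / qpoch (a * p) p k) *
  (qpoch (1 / p ^+ N) p k / qpoch (p * u) p k) *
  (u * (p ^+ 2 / Y ^+ 3 / (c * e))) ^+ k).
  rewrite mulr_sumr; apply: eq_bigr => k _; rewrite /twisted_term [(u * _) ^+ k]exprMn.
  move: ((_ / (c * e)) ^+ k) (u ^+ k) => zk uk.
  by field; rewrite ?np ?nc ?ne ?na ?na' ?npu ?Y1 ?w0.
rewrite E 3!mulr_sumr; apply: eq_bigr => k _.
move: ((p / Y) ^+ k) => zk.
transitivity (((1 - Y) * qpoch (Y * p) p N) / w
  * (qpoch p p N / (qpoch (p / a) p N * qpoch (a * p) p N)) *
  (qpoch (p / Y) p (N - k) * zk / qpoch p p (N - k) *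
  (qpoch (p / Y / (c * e)) p k * qpoch (a * Y) p k * qpoch (Y / a) p k /
   (qpoch p p k * qpoch (p / c) p k * qpoch (p / e) p k)))).
  by field; rewrite ?np ?nc ?ne ?na ?na' ?w0.
by rewrite -qY; field; rewrite ?np ?nc ?ne ?na ?na' ?w0.
Qed.

(** * First-order effect of the twist, and its cancellation *)

Definition harmonic (F : fieldType) (p : F) (k : nat) : F :=
  \sum_(i < k) (1 - p * p ^+ i)^-1.
Arguments harmonic {F} p k.

(* The coefficient E_k of h: the logarithmic derivative at u = 1 of the ratio
   between the original and the twisted factor, see [twist_ratio]. *)
Definition log_slope (F : fieldType) (p : F) (N k : nat) : F :=
  harmonic p k + harmonic p (N - k) - harmonic p N.
Arguments log_slope {F} p N k.

Lemma in_subring_unit (F : fieldType) (R : subring_pred F) x : unit_in R x -> R x.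
Proof. by case. Qed.

Lemma in_subring_unitV (F : fieldType) (R : subring_pred F) x : unit_in R x -> R x^-1.
Proof. by case. Qed.

Ltac unit_in_tac :=
  repeat first [ assumption | apply: unit_in1 | apply: unit_inM | apply: unit_inV
               | apply: unit_inX ].

Ltac in_subring_tac :=
  repeat first [ assumption
    | by apply: in_subring_unit
    | apply: in_subring1
    | apply: in_subringB | apply: in_subringD | apply: in_subringN
    | apply: in_subringM | apply: in_subringX | apply: in_subring_qpoch
    | by apply: in_subring_unitV; unit_in_tac ].

Lemma in_subring_log_slope (F : fieldType) (R : subring_pred F) (p : F) N k :
  (forall i, (i < N)%N -> unit_in R (1 - p * p ^+ i)) -> (k <= N)%N ->
  R (log_slope p N k).
Proof.
move=> h lekN.
have Rh j : (j <= N)%N -> R (harmonic p j).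
  move=> lejN; apply: (@in_subring_sum F R j (fun i => (1 - p * p ^+ i)^-1)) => i lt_ij.
  by apply/in_subring_unitV/h/(leq_trans lt_ij).
by apply: in_subringB; [apply: in_subringD|]; apply: Rh => //; rewrite leq_subr.
Qed.

(** The ratio is a product over i < k whose i-th factor is 1 + h eps_i up to a multiple of h^2; the
    eps_i add up to the slope. *)
Lemma twist_ratio (F : fieldType) (R : subring_pred F) phi p Y u a c e w N k :
  admissible R phi p Y u a c e w N -> (k <= N)%N ->
  eqmod_in R (phi * phi) (qpoch Y p k / qpoch p p k)
    ((1 + (1 - u) * log_slope p N k)
     * (u ^+ k * qpoch (1 / p ^+ N) p k / qpoch (p * u) p k)).
Proof.
move=> H; have [p0 Rp _] := adm_p H; have [Y0 RY _] := adm_Y H.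
have Up := adm_p H; have UY := adm_Y H; have RpV : R (1 / p ^+ N) by in_subring_tac.
have defu := adm_u H; have [z Rz hz] := adm_dvd H; have Rphi := adm_phi H.
have Ru : R u by rewrite defu; in_subring_tac.
have pN0 : p ^+ N != 0 by rewrite expf_neq0.
have hp i (lt_iN : (i < N)%N) := adm_1p H i lt_iN.
elim: k => [|k IH] lekN.
  rewrite !qpoch0 /log_slope /harmonic big_ord0 subn0 add0r subrr mulr0 addr0 !divr1 !mul1r.
  by apply: eqmod_refl; apply: in_subring1.
have {}IH := IH (ltnW lekN).
have U1 := hp k lekN; have U2 := adm_1pu H k lekN.
have lt_l : (N - k.+1 < N)%N by lia.
have U3 := hp _ lt_l.
have Up1 : unit_in R (qpoch p p k).
  by apply: unit_in_qpoch => i lt_ik; apply: hp; lia.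
have Up2 : unit_in R (qpoch (p * u) p k).
  by apply: unit_in_qpoch => i lt_ik; apply: (adm_1pu H); lia.
have RE := in_subring_log_slope _ R p N k hp (ltnW lekN).
have RE' := in_subring_log_slope _ R p N k.+1 hp lekN.
have [n1 _ _] := U1; have [n2 _ _] := U2; have [n3 _ _] := U3.
have [np1 _ _] := Up1; have [np2 _ _] := Up2.
(* The coefficient of h = 1 - u in the expansion of [b1 / b2] at u = 1, where Y = u p^-N varies with
   u. *)
set eps := (1 - p * p ^+ k)^-1 - (1 - p * p ^+ (N - k.+1))^-1.
have Reps : R eps by rewrite /eps; in_subring_tac.
have slope : log_slope p N k.+1 = log_slope p N k + eps.
  have hS j : harmonic p j.+1 = harmonic p j + (1 - p * p ^+ j)^-1.
    exact: big_ord_recr.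
  by rewrite /log_slope /eps -(subnSK lekN) !hS; ring.
pose b1 := (1 - Y * p ^+ k) / (1 - p * p ^+ k).
pose b2 := u * (1 - 1 / p ^+ N * p ^+ k) / (1 - p * u * p ^+ k).
have Rb1 : R b1 by rewrite /b1; in_subring_tac.
have Rb2 : R b2 by rewrite /b2; in_subring_tac.
have step : eqmod_in R (phi * phi) b1 ((1 + (1 - u) * eps) * b2).
  split=> //; first by in_subring_tac.
  (* The error is exactly h^2/((1 - p^(k+1))(1 - u p^(k+1))). *)
  exists (z * z * ((1 - p * p ^+ k)^-1 * (1 - p * u * p ^+ k)^-1)); first by in_subring_tac.
  have -> : phi * phi * (z * z * ((1 - p * p ^+ k)^-1 * (1 - p * u * p ^+ k)^-1))
    = (1 - u) ^+ 2 / ((1 - p * p ^+ k) * (1 - p * u * p ^+ k)).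
    by rewrite hz; field; rewrite ?n1 ?n2.
  have defs : p ^+ N = p * p ^+ (N - k.+1) * p ^+ k.
    by rewrite -exprS -exprD subnSK // subnK // ltnW.
  have defY : Y = u / p ^+ N by rewrite defu; field.
  rewrite /b1 /b2 /eps defY defs.
  have pk0 : p ^+ k != 0 by rewrite expf_neq0.
  have pl0 : p ^+ (N - k.+1) != 0 by rewrite expf_neq0.
  by field; rewrite ?n1 ?n2 ?n3 ?p0 ?pk0 ?pl0.
have -> : qpoch Y p k.+1 / qpoch p p k.+1 = qpoch Y p k / qpoch p p k * b1.
  by rewrite !qpochS /b1; field; rewrite ?n1 ?np1.
apply: eqmod_trans (eqmodM _ _ _ _ _ _ _ IH step) _.
have -> : u ^+ k.+1 * qpoch (1 / p ^+ N) p k.+1 / qpoch (p * u) p k.+1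
  = u ^+ k * qpoch (1 / p ^+ N) p k / qpoch (p * u) p k * b2.
  by rewrite !qpochS /b2 exprS; field; rewrite ?n2 ?np2 ?pN0.
set B := u ^+ k * qpoch (1 / p ^+ N) p k / qpoch (p * u) p k.
have RB : R B by rewrite /B; in_subring_tac.
split; try by in_subring_tac.
(* The cross term of (1 + h E_k)(1 + h eps). *)
exists (z * z * (log_slope p N k * eps * B * b2)); first by in_subring_tac.
have -> : phi * phi * (z * z * (log_slope p N k * eps * B * b2))
  = (1 - u) ^+ 2 * (log_slope p N k * eps * B * b2) by rewrite hz; ring.
by rewrite slope; ring.
Qed.

Lemma sum_antisymmetric (F : fieldType) (f : nat -> F) (N : nat) :
  2%:R != 0 :> F -> (forall k, (k <= N)%N -> f (N - k)%N = - f k) ->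
  \sum_(k < N.+1) f k = 0.
Proof.
move=> two0 hf; apply: (mulfI two0); rewrite mulr0 mulr_natl mulr2n.
rewrite {1}(reindex_inj rev_ord_inj) -big_split big1 //= => -[k /=].
by rewrite ltnS => lekN _; rewrite subSS hf // addNr.
Qed.

(** With Y = p^-(k+l) every numerator is a shifted factorial that [qpoch_shift] reverses. The result
    is symmetric in k and l except for the difference of p^-k and p^-l, which changes sign: hence
    the antisymmetry. *)
Lemma lhs_term_closed (F : fieldType) (p a c e w : F) (k l : nat) :
  p != 0 -> a != 0 -> c != 0 -> e != 0 -> w != 0 ->
  qpoch p p k != 0 -> qpoch p p l != 0 ->
  (forall i, qpoch (p / c) p i != 0) -> (forall i, qpoch (p / e) p i != 0) ->
  (forall i, qpoch (p / a) p i != 0) -> (forall i, qpoch (a * p) p i != 0) ->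
  lhs_term p (1 / p ^+ (k + l)) a c e w k
  = ((p ^+ k)^-1 - (p ^+ l)^-1) / w / p ^+ k ^+ l ^+ 3 *
    (qpoch p p (k + l) / (qpoch p p k * qpoch p p l)) ^+ 2 *
    (qpoch (p / c) p (k + l) / (qpoch (p / c) p k * qpoch (p / c) p l)) *
    (qpoch (p / e) p (k + l) / (qpoch (p / e) p k * qpoch (p / e) p l)) *
    (qpoch (p / a) p (k + l) / (qpoch (p / a) p k * qpoch (p / a) p l)) *
    (qpoch (a * p) p (k + l) / (qpoch (a * p) p k * qpoch (a * p) p l)).
Proof.
move=> p0 a0 c0 e0 w0 nk nl nc ne na na'.
have nX (x : F) i : x != 0 -> x ^+ i != 0 := fun x0 => expf_neq0 i x0.
have hx x : x != 0 -> qpoch (p / x) p l != 0 ->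
    qpoch (x / p ^+ (k + l)) p k = (- x) ^+ k * p ^+ 'C(k, 2) * qpoch (p / x) p (k + l)
      / (p ^+ (k + l) ^+ k * qpoch (p / x) p l).
  move=> x0 nx; have := @qpoch_shift F p x (k + l) k p0 x0 (leq_addr _ _).
  by rewrite addKn => <-; field; rewrite ?nx ?nX.
pose r x := qpoch (p / x) p (k + l) / (qpoch (p / x) p k * qpoch (p / x) p l).
have hr x : x != 0 -> qpoch (p / x) p k != 0 -> qpoch (p / x) p l != 0 ->
    qpoch (x / p ^+ (k + l)) p k / qpoch (p / x) p k
    = (- x) ^+ k * p ^+ 'C(k, 2) / p ^+ (k + l) ^+ k * r x.
  by move=> x0 nxk nxl; rewrite hx // /r; field; rewrite ?nxk ?nxl ?nX.
have pa : p / a^-1 = a * p by rewrite invrK mulrC.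
have h1 := hr 1 (oner_neq0 _); have ha' := hr a^-1 (invr_neq0 a0).
rewrite pa in ha'; rewrite divr1 in h1.
have -> : lhs_term p (1 / p ^+ (k + l)) a c e w k =
  (1 - 1 / p ^+ (k + l) * p ^+ (2 * k)) / w *
  (qpoch (1 / p ^+ (k + l)) p k / qpoch p p k) ^+ 2 *
  (qpoch (c / p ^+ (k + l)) p k / qpoch (p / c) p k) *
  (qpoch (e / p ^+ (k + l)) p k / qpoch (p / e) p k) *
  (qpoch (a / p ^+ (k + l)) p k / qpoch (p / a) p k) *
  (qpoch (a^-1 / p ^+ (k + l)) p k / qpoch (a * p) p k) *
  (p ^+ 2 / (1 / p ^+ (k + l)) ^+ 3 / (c * e)) ^+ k.
  have hcx x : x * (1 / p ^+ (k + l)) = x / p ^+ (k + l) by rewrite mul1r.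
  have hax : 1 / p ^+ (k + l) / a = a^-1 / p ^+ (k + l) by rewrite mul1r mulrC.
  rewrite /lhs_term !hcx hax; move: (_ ^+ k) (1 - _) => zk y.
  by field; rewrite ?w0 ?nk ?nc ?ne ?na ?na'.
rewrite h1 // !hr // ha' //.
have -> : (qpoch p p (k + l) / (qpoch p p k * qpoch p p l)) = r 1 by rewrite /r divr1.
have -> : (qpoch (a * p) p (k + l) / (qpoch (a * p) p k * qpoch (a * p) p l)) = r a^-1.
  by rewrite /r pa.
rewrite -/(r c) -/(r e) -/(r a); clear hr hx h1 ha'.
move: (r 1) (r c) (r e) (r a) (r a^-1) => r1 rc re ra ra'.
rewrite [(- a) ^+ k]exprNn [(- c) ^+ k]exprNn [(- e) ^+ k]exprNn [(- a^-1) ^+ k]exprNn.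
have zE : (p ^+ 2 / (1 / p ^+ (k + l)) ^+ 3 / (c * e)) ^+ k
   = p ^+ k ^+ 2 * p ^+ (k + l) ^+ k ^+ 3 / (c ^+ k * e ^+ k).
  have -> : p ^+ 2 / (1 / p ^+ (k + l)) ^+ 3 / (c * e) = p ^+ 2 * p ^+ (k + l) ^+ 3 / (c * e).
    by field; rewrite ?c0 ?e0 ?nX ?oner_neq0.
  by rewrite expr_div_n [(p ^+ 2 * _) ^+ k]exprMn [(c * e) ^+ k]exprMn [p ^+ 2 ^+ k]exprAC [_ ^+ 3 ^+ k]exprAC.
have aVk : a^-1 ^+ k = (a ^+ k)^-1 by rewrite exprVn.
have pp : p ^+ (k + l) ^+ k = p ^+ 'C(k, 2) ^+ 2 * p ^+ k * p ^+ k ^+ l.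
  have bk := bin2_double k.
  by rewrite -!exprM -!exprD; congr (_ ^+ _); nia.
have p2 : 1 / p ^+ (k + l) * p ^+ (2 * k) = p ^+ k / p ^+ l.
  by rewrite mul2n -addnn !exprD; field; rewrite ?nX.
rewrite zE aVk pp p2.
(* The signs occur to an even total power; the case split lets [field] cancel them. *)
have sgn : (-1) ^+ k = 1 :> F \/ (-1) ^+ k = -1 :> F.
  by rewrite -signr_odd; case: (odd k) => /=; [right|left].
case: sgn => ->; move: (p ^+ 'C(k, 2)) (nX p 'C(k, 2) p0) 
  (p ^+ k) (nX p k p0) (p ^+ l) (nX p l p0) (a ^+ k) (nX a k a0) (c ^+ k) (nX c k c0)
  (e ^+ k) (nX e k e0) => C nC P nP Q nQ A nA C' nC' E nE;
  by field; rewrite ?nC ?nP ?nQ ?nA ?nC' ?nE ?w0 ?expf_neq0.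
Qed.

Lemma lhs_term_antisymmetric (F : fieldType) (p a c e w : F) (N k : nat) :
  p != 0 -> a != 0 -> c != 0 -> e != 0 -> w != 0 ->
  (forall i, 1 - p * p ^+ i != 0) ->
  (forall i, 1 - p / c * p ^+ i != 0) -> (forall i, 1 - p / e * p ^+ i != 0) ->
  (forall i, 1 - p / a * p ^+ i != 0) -> (forall i, 1 - a * p * p ^+ i != 0) ->
  (k <= N)%N ->
  lhs_term p (1 / p ^+ N) a c e w (N - k) = - lhs_term p (1 / p ^+ N) a c e w k.
Proof.
move=> p0 a0 c0 e0 w0 hp hc he ha ha' lekN.
have np i := @qpoch_neq0 _ p p i hp; have nc i := @qpoch_neq0 _ _ p i hc.
have ne i := @qpoch_neq0 _ _ p i he; have na i := @qpoch_neq0 _ _ p i ha.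
have na' i := @qpoch_neq0 _ _ p i ha'.
have [l ->] : exists l, N = (k + l)%N by exists (N - k)%N; rewrite subnKC.
rewrite addKn {1}addnC !lhs_term_closed // (addnC l).
have -> : p ^+ l ^+ k = p ^+ k ^+ l by rewrite -!exprM mulnC.
by field; rewrite ?expf_neq0 ?p0 ?w0 ?np ?nc ?ne ?na ?na'.
Qed.

Ltac eqmod_tac :=
  repeat first [ assumption
    | by apply: eqmod_refl; in_subring_tac
    | apply: eqmodX
    | apply: eqmod_qpoch; [by in_subring_tac|]
    | apply: eqmodV; [by unit_in_tac|by unit_in_tac|]
    | apply: eqmodM | apply: eqmodB | apply: eqmodD ].

(** At u = 1 the twist is trivial. The limit is thus a twisted term itself, and can be compared with
    the one at u factor by factor. *)
Lemma lhs_term_twisted (F : fieldType) (p Y a c e w : F) (N k : nat) :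
  Y = 1 / p ^+ N -> lhs_term p Y a c e w k = twisted_term p Y 1 a c e w N k.
Proof.
by move=> ->; rewrite /lhs_term /twisted_term expr1n [1 * qpoch _ _ _]mul1r [p * 1]mulr1 !expr2.
Qed.

Lemma eqmod_twisted_term (F : fieldType) (R : subring_pred F) phi p Y u a c e w N k :
  admissible R phi p Y u a c e w N -> (k <= N)%N ->
  eqmod_in R phi (twisted_term p Y u a c e w N k) (lhs_term p (1 / p ^+ N) a c e w k).
Proof.
move=> H lekN; have Up := adm_p H; have UY := adm_Y H; have Ua := adm_a H.
have Uc := adm_c H; have Ue := adm_e H; have Uw := adm_w H; have Rphi := adm_phi H.
have defu := adm_u H; have [z Rz hz] := adm_dvd H.
have Uu : unit_in R u by rewrite defu; unit_in_tac.
have U1 : unit_in R (1 / p ^+ N) by unit_in_tac.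
have Ek : eqmod_in R phi Y (1 / p ^+ N).
  split; try by apply: in_subring_unit.
  exists (- (z / p ^+ N)); first by in_subring_tac.
  have [p0 _ _] := Up; have pN0 := expf_neq0 N p0.
  by rewrite mulrN mulrA -hz defu; field; rewrite ?pN0.
have Eu : eqmod_in R phi u 1.
  split; [by apply: in_subring_unit|exact: in_subring1|exists (- z); first by in_subring_tac].
  by rewrite mulrN -hz; ring.
have q1 : unit_in R (qpoch p p k).
  by apply: unit_in_qpoch => i lt_ik; apply: (adm_1p H); lia.
have q2 : unit_in R (qpoch (p * u) p k).
  by apply: unit_in_qpoch => i lt_ik; apply: (adm_1pu H); lia.
have q2' : unit_in R (qpoch (p * 1) p k) by rewrite mulr1.
have q3 : unit_in R (qpoch (p / c) p k) by apply: unit_in_qpoch => i _; apply: (adm_1pc H).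
have q4 : unit_in R (qpoch (p / e) p k) by apply: unit_in_qpoch => i _; apply: (adm_1pe H).
have q5 : unit_in R (qpoch (p / a) p k) by apply: unit_in_qpoch => i _; apply: (adm_1pVa H).
have q6 : unit_in R (qpoch (a * p) p k) by apply: unit_in_qpoch => i _; apply: (adm_1pa H).
rewrite (lhs_term_twisted _ _ _ _ _ _ _ N) // /twisted_term.
by eqmod_tac.
Qed.

Lemma lhs_twisted_mod (F : fieldType) (R : subring_pred F) phi p Y u a c e w N :
  admissible R phi p Y u a c e w N ->
  eqmod_in R (phi * phi) (\sum_(k < N.+1) lhs_term p Y a c e w k)
    (\sum_(k < N.+1) twisted_term p Y u a c e w N k).
Proof.
move=> H; have Up := adm_p H; have UY := adm_Y H; have Ua := adm_a H.
have Uc := adm_c H; have Ue := adm_e H; have Uw := adm_w H; have Rphi := adm_phi H.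
have defu := adm_u H; have [z Rz hz] := adm_dvd H.
have Uu : unit_in R u by rewrite defu; unit_in_tac.
have R1u : R (1 - u) by in_subring_tac.
have Rslope k : (k <= N)%N -> R (log_slope p N k).
  by apply: in_subring_log_slope; apply: (adm_1p H).
pose tw k := twisted_term p Y u a c e w N k.
pose lim k := lhs_term p (1 / p ^+ N) a c e w k.
have tw_lim k : (k <= N)%N -> eqmod_in R phi (tw k) (lim k).
  by move=> lekN; apply: eqmod_twisted_term.
have Rtw k : (k <= N)%N -> R (tw k) by move=> /tw_lim[].
have termwise k : (k <= N)%N ->
    eqmod_in R (phi * phi) (lhs_term p Y a c e w k) ((1 + (1 - u) * log_slope p N k) * tw k).
  move=> lekN; have q3 : unit_in R (qpoch (p / c) p k).
    by apply: unit_in_qpoch => i _; apply: (adm_1pc H).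
  have q4 : unit_in R (qpoch (p / e) p k) by apply: unit_in_qpoch => i _; apply: (adm_1pe H).
  have q5 : unit_in R (qpoch (p / a) p k) by apply: unit_in_qpoch => i _; apply: (adm_1pVa H).
  have q6 : unit_in R (qpoch (a * p) p k) by apply: unit_in_qpoch => i _; apply: (adm_1pa H).
  have q1 : unit_in R (qpoch p p k).
    by apply: unit_in_qpoch => i lt_ik; apply: (adm_1p H); lia.
  have q2 : unit_in R (qpoch (p * u) p k).
    by apply: unit_in_qpoch => i lt_ik; apply: (adm_1pu H); lia.
  (* The term without the one factor (Y;p)_k/(p;p)_k that [twist_ratio] replaces. *)
  pose A := (1 - Y * p ^+ (2 * k)) / w *
    (qpoch Y p k * qpoch (c * Y) p k * qpoch (e * Y) p k * qpoch (a * Y) p k * qpoch (Y / a) p k)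
    / (qpoch p p k * qpoch (p / c) p k * qpoch (p / e) p k * qpoch (p / a) p k * qpoch (a * p) p k)
    * (p ^+ 2 / Y ^+ 3 / (c * e)) ^+ k.
  have RA : R A by rewrite /A; in_subring_tac.
  have := eqmodM _ _ _ _ _ _ _ (eqmod_refl _ R (phi * phi) A RA) (twist_ratio _ _ _ _ _ _ _ _ _ _ _ _ H lekN).
  have [n1 _ _] := q1; have [n2 _ _] := q2; have [n3 _ _] := q3; have [n4 _ _] := q4.
  have [n5 _ _] := q5; have [n6 _ _] := q6; have [w0 _ _] := Uw.
  have -> : A * (qpoch Y p k / qpoch p p k) = lhs_term p Y a c e w k.
    rewrite /A /lhs_term; move: (_ ^+ k) => zk.
    by field; rewrite ?n1 ?n2 ?n3 ?n4 ?n5 ?n6 ?w0.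
  suff -> : A * ((1 + (1 - u) * log_slope p N k) *
       (u ^+ k * qpoch (1 / p ^+ N) p k / qpoch (p * u) p k))
     = (1 + (1 - u) * log_slope p N k) * tw k by [].
  rewrite /A /tw /twisted_term; move: ((_ / (c * e)) ^+ k) (u ^+ k) => zk uk.
  move: (1 + _) => x.
  by field; rewrite ?n1 ?n2 ?n3 ?n4 ?n5 ?n6 ?w0.
have := eqmod_sum F R (phi * phi) N.+1 (fun k => lhs_term p Y a c e w k)
  (fun k => (1 + (1 - u) * log_slope p N k) * tw k) termwise.
move/eqmod_trans; apply.
have -> : \sum_(k < N.+1) (1 + (1 - u) * log_slope p N k) * tw k
   = \sum_(k < N.+1) tw k + (1 - u) * \sum_(k < N.+1) log_slope p N k * tw k.
  by rewrite mulr_sumr -big_split; apply: eq_bigr => k _ /=; ring.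
have lim0 : \sum_(k < N.+1) log_slope p N k * lim k = 0.
  apply: (@sum_antisymmetric F (fun k => log_slope p N k * lim k) N (adm_two H)) => k lekN.
  have nz x : unit_in R x -> x != 0 by case.
  rewrite /lim lhs_term_antisymmetric //; try by apply: nz.
  - by rewrite /log_slope subKn // [harmonic p (N - k) + _]addrC mulrN.
  - exact: adm_np H.
  - by move=> i; apply/nz/(adm_1pc H).
  - by move=> i; apply/nz/(adm_1pe H).
  - by move=> i; apply/nz/(adm_1pVa H).
  - by move=> i; apply/nz/(adm_1pa H).
(* The vanishing sum is inserted so that, thanks to the factor 1 - u, only a congruence modulo [phi]
   between the weighted terms remains. *)
rewrite [X in eqmod_in _ _ _ X](_ : _
   = \sum_(k < N.+1) tw k + (1 - u) * \sum_(k < N.+1) log_slope p N k * lim k); last first.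
  by rewrite lim0 mulr0 addr0.
apply: eqmodD; first by apply: eqmod_refl; apply: (@in_subring_sum F R N.+1 tw).
apply: eqmod_lift => //; first by exists z.
apply: (eqmod_sum F R phi N.+1 (fun k => log_slope p N k * tw k)
  (fun k => log_slope p N k * lim k)) => k lekN.
by apply: eqmodM; [apply/eqmod_refl/Rslope|apply: tw_lim].
Qed.

(** * Comparison of the twisted and terminating sums with the right-hand side *)

Definition rhs_value (F : fieldType) (p Y u a c e w : F) (N : nat) : F :=
  (1 - u) / w *
  (Y ^- N * (1 - a * u) * (a - u) / (1 - a) ^+ 2 *
     (1 / qpoch p p N - qpoch p p N / (qpoch (p / a) p N * qpoch (a * p) p N))
   + Y ^- N / qpoch p p N)
  * \sum_(k < N.+1) rhs_term p Y a c e N k.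
Arguments rhs_value {F} p Y u a c e w N.

Lemma in_subring_rhs_term (F : fieldType) (R : subring_pred F) phi p Y u a c e w N k :
  admissible R phi p Y u a c e w N -> (k <= N)%N -> R (rhs_term p Y a c e N k).
Proof.
move=> H lekN; have Up := adm_p H; have UY := adm_Y H; have Ua := adm_a H.
have Uc := adm_c H; have Ue := adm_e H.
have q1 : unit_in R (qpoch p p k).
  by apply: unit_in_qpoch => i lt_ik; apply: (adm_1p H); lia.
have q3 : unit_in R (qpoch (p / c) p k) by apply: unit_in_qpoch => i _; apply: (adm_1pc H).
have q4 : unit_in R (qpoch (p / e) p k) by apply: unit_in_qpoch => i _; apply: (adm_1pe H).
by rewrite /rhs_term; in_subring_tac.
Qed.

Lemma twisted_rhs_mod (F : fieldType) (R : subring_pred F) phi p Y u a c e w N :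
  admissible R phi p Y u a c e w N ->
  eqmod_in R (phi * phi) (\sum_(k < N.+1) twisted_term p Y u a c e w N k)
    (rhs_value p Y u a c e w N).
Proof.
move=> H; have Up := adm_p H; have UY := adm_Y H; have Ua := adm_a H.
have Uc := adm_c H; have Ue := adm_e H; have Uw := adm_w H; have Rphi := adm_phi H.
have U1a := adm_1a H.
have defu := adm_u H; have [z Rz hz] := adm_dvd H.
have Uu : unit_in R u by rewrite defu; unit_in_tac.
have q1 k : (k <= N)%N -> unit_in R (qpoch p p k).
  by move=> lekN; apply: unit_in_qpoch => i lt_ik; apply: (adm_1p H); lia.
have q3 k : unit_in R (qpoch (p / c) p k) by apply: unit_in_qpoch => i _; apply: (adm_1pc H).
have q4 k : unit_in R (qpoch (p / e) p k) by apply: unit_in_qpoch => i _; apply: (adm_1pe H).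
have q5 k : unit_in R (qpoch (p / a) p k) by apply: unit_in_qpoch => i _; apply: (adm_1pVa H).
have q6 k : unit_in R (qpoch (a * p) p k) by apply: unit_in_qpoch => i _; apply: (adm_1pa H).
have q1N := q1 N (leqnn N).
have Eu : eqmod_in R phi u 1.
  split; [by apply: in_subring_unit|exact: in_subring1|exists (- z); first by in_subring_tac].
  by rewrite mulrN -hz; ring.
have Eu' : eqmod_in R phi 1 u by apply: eqmod_sym.
rewrite (twisted_sum _ _ _ _ _ _ _ _ _ _ _ H) /rhs_value.
rewrite -[X in eqmod_in _ _ X _]mulrA -[X in eqmod_in _ _ _ X]mulrA.
apply: eqmod_lift; [by in_subring_tac| |].
  by exists (z / w); [in_subring_tac|rewrite mulrA -hz].
have [Y0 _ _] := UY; have [p0 _ _] := Up; have [u0 _ _] := Uu.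
have [n1a _ _] := U1a; have YN0 : Y ^+ N != 0 by rewrite expf_neq0.
have pN0 : p ^+ N != 0 by rewrite expf_neq0.
set K := qpoch p p N / (qpoch (p / a) p N * qpoch (a * p) p N).
have RK : R K by rewrite /K; in_subring_tac.
(* At u = 1 the quotient (1 - au)(a - u)/(1 - a)^2 is -1, so the two terms with 1/(p;p)_N cancel. *)
have EQ : eqmod_in R phi (K * Y ^- N) (Y ^- N * (1 - a * u) * (a - u) / (1 - a) ^+ 2 *
     (1 / qpoch p p N - K) + Y ^- N / qpoch p p N).
  have -> : K * Y ^- N = Y ^- N * (1 - a * 1) * (a - 1) / (1 - a) ^+ 2 *
     (1 / qpoch p p N - K) + Y ^- N / qpoch p p N.
    by have [nq _ _] := q1N; move: K RK => K RK; field; rewrite ?n1a ?nq ?YN0.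
  by eqmod_tac.
apply: eqmod_trans (eqmodM _ _ _ _ _ _ _ EQ (eqmod_refl _ _ _ _ _)); last first.
  apply: (@in_subring_sum F R N.+1 (fun k => rhs_term p Y a c e N k)) => k lekN.
  exact: in_subring_rhs_term H lekN.
rewrite -[X in eqmod_in _ _ _ X]mulrA; apply: eqmodM; first exact: eqmod_refl.
rewrite mulr_sumr; apply: (eqmod_sum F R phi N.+1 (fun k =>
        qpoch Y p N * qpoch (p / Y) p (N - k) * (p / Y) ^+ k / qpoch p p (N - k)
        * (qpoch (p / Y / (c * e)) p k * qpoch (a * Y) p k * qpoch (Y / a) p k
           / (qpoch p p k * qpoch (p / c) p k * qpoch (p / e) p k)))
   (fun k => Y ^- N * rhs_term p Y a c e N k)) => k; rewrite ltnS => lekN.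
have q1k := q1 k lekN; have q1l := q1 _ (leq_subr k N).
have q3k := q3 k; have q4k := q4 k.
set X := qpoch (p / Y / (c * e)) p k * qpoch (a * Y) p k * qpoch (Y / a) p k
   / (qpoch p p k * qpoch (p / c) p k * qpoch (p / e) p k).
have RX : R X by rewrite /X; in_subring_tac.
have -> : Y ^- N * rhs_term p Y a c e N k
  = Y ^- N * qpoch p p N * qpoch p p (N - k) * qpoch (Y ^+ 2 * p ^+ k) p (N - k)
    * qpoch Y p k * p ^+ k * ((qpoch p p N)^-1 * (qpoch p p (N - k))^-1) * X.
  have [n1 _ _] := q1k; have [n2 _ _] := q1l; have [n3 _ _] := q3k; have [n4 _ _] := q4k.
  have [n5 _ _] := q1N.
  by rewrite /X /rhs_term; field; rewrite ?n1 ?n2 ?n3 ?n4 ?n5 ?YN0.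
have -> : qpoch Y p N * qpoch (p / Y) p (N - k) * (p / Y) ^+ k / qpoch p p (N - k)
  = qpoch Y p N * qpoch (p / Y) p (N - k) * (p / Y) ^+ k * qpoch p p N
    * ((qpoch p p N)^-1 * (qpoch p p (N - k))^-1).
  have [n2 _ _] := q1l; have [n5 _ _] := q1N.
  by move: (_ ^+ k) => zk; field; rewrite ?n2 ?n5.
do 2!(apply: eqmodM; last by apply: eqmod_refl; in_subring_tac).
(* The identity is exact. Once p^N is expressed through u, replacing u by 1 turns its two sides into
   the two terms to be compared. *)
have := @reversal_identity F p Y N k p0 Y0 lekN.
have -> : p / (Y ^+ 2 * p ^+ N) = p / Y / u by rewrite defu; field; rewrite ?pN0 ?Y0.
have -> : p / (Y * p ^+ N) = p / u by rewrite defu.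
have -> : 1 / p ^+ N = Y / u by rewrite defu; field; rewrite ?pN0 ?Y0.
move=> rev; have U1 := unit_in1 F R.
have U1' : eqmod_in R phi 1 1 by apply: eqmod_refl; apply: in_subring1.
apply: (@eqmod_trans F R phi (qpoch Y p N * qpoch (p / Y / u) p (N - k) * (p / Y / u) ^+ k * qpoch p p N)).
  rewrite -{1 2}[p / Y]divr1.
  by eqmod_tac.
have -> : Y ^- N * qpoch p p N * qpoch p p (N - k) * qpoch (Y ^+ 2 * p ^+ k) p (N - k)
    * qpoch Y p k * p ^+ k
  = Y ^- N * qpoch (p / 1) p N * qpoch p p (N - k) * qpoch (Y ^+ 2 * p ^+ k) p (N - k)
    * qpoch (Y / 1) p k * p ^+ k by rewrite !divr1.
rewrite rev.
by eqmod_tac.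
Qed.

(** The symmetry between a and 1/a reduces the evaluation at a = 1/u to the one at a = u. *)
Lemma lhs_term_inv (F : fieldType) (p Y a c e w : F) k :
  lhs_term p Y a^-1 c e w k = lhs_term p Y a c e w k.
Proof.
rewrite /lhs_term invrK (mulrC p a) (mulrC Y a) (mulrC a^-1 Y) (mulrC a^-1 p).
by congr (_ * _ / _ * _); rewrite mulrAC.
Qed.

Lemma rhs_term_inv (F : fieldType) (p Y a c e : F) N k :
  rhs_term p Y a^-1 c e N k = rhs_term p Y a c e N k.
Proof.
rewrite /rhs_term invrK (mulrC Y a) (mulrC a^-1 Y).
by congr (_ * _ / _ * _); rewrite mulrAC.
Qed.

Lemma lhs_rhs_mod_at (F : fieldType) (R : subring_pred F) phi p Y u a c e w N m b :
  admissible R phi p Y u a c e w N -> b = u \/ b = u^-1 ->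
  eqmod_in R m a b -> (exists2 z, R z & (1 - a * u) * (a - u) = m * z) ->
  eqmod_in R m (\sum_(k < N.+1) lhs_term p Y a c e w k) (rhs_value p Y u a c e w N).
Proof.
move=> H hb Eab [z Rz hz]; have Up := adm_p H; have UY := adm_Y H; have Ua := adm_a H.
have Uc := adm_c H; have Ue := adm_e H; have Uw := adm_w H; have U1a := adm_1a H.
have defu := adm_u H.
have Uu : unit_in R u by rewrite defu; unit_in_tac.
have Ub : unit_in R b by case: hb => ->; unit_in_tac.
have q1 k : (k <= N)%N -> unit_in R (qpoch p p k).
  by move=> lekN; apply: unit_in_qpoch => i lt_ik; apply: (adm_1p H); lia.
have q3 k : unit_in R (qpoch (p / c) p k) by apply: unit_in_qpoch => i _; apply: (adm_1pc H).
have q4 k : unit_in R (qpoch (p / e) p k) by apply: unit_in_qpoch => i _; apply: (adm_1pe H).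
have q5 k : unit_in R (qpoch (p / a) p k) by apply: unit_in_qpoch => i _; apply: (adm_1pVa H).
have q6 k : unit_in R (qpoch (a * p) p k) by apply: unit_in_qpoch => i _; apply: (adm_1pa H).
have qu k : (k <= N)%N -> unit_in R (qpoch (p * u) p k).
  by move=> lekN; apply: unit_in_qpoch => i lt_ik; apply: (adm_1pu H); lia.
have qVu k : (k <= N)%N -> unit_in R (qpoch (p / u) p k).
  by move=> lekN; apply: unit_in_qpoch => i lt_ik; apply: (adm_1pVu H); lia.
(* For the special value b these factors are only known to be units up to k = N, in contrast with
   those containing a. *)
have q5b k : (k <= N)%N -> unit_in R (qpoch (p / b) p k).
  by case: hb => -> lekN; rewrite ?invrK; [apply: qVu|apply: qu].
have q6b k : (k <= N)%N -> unit_in R (qpoch (b * p) p k).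
  by case: hb => -> lekN; rewrite mulrC; [apply: qu|apply: qVu].
have q1N := q1 N (leqnn N); have q5N := q5 N; have q6N := q6 N.
have Lb : \sum_(k < N.+1) lhs_term p Y b c e w k
    = (1 - u) / w * (Y ^- N / qpoch p p N) * \sum_(k < N.+1) rhs_term p Y b c e N k.
  case: hb => ->; first exact: lhs_at_u H.
  under eq_bigr => k _ do rewrite lhs_term_inv.
  under [in RHS]eq_bigr => k _ do rewrite rhs_term_inv.
  exact: lhs_at_u H.
apply: (@eqmod_trans _ _ _ (\sum_(k < N.+1) lhs_term p Y b c e w k)).
  apply: (eqmod_sum F R m N.+1 (lhs_term p Y a c e w) (lhs_term p Y b c e w)) => k lekN.
  have q1k := q1 k lekN; have q3k := q3 k; have q4k := q4 k; have q5k := q5 k.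
  have q6k := q6 k; have q5bk := q5b k lekN; have q6bk := q6b k lekN.
  by rewrite /lhs_term; eqmod_tac.
rewrite Lb; apply: (@eqmod_trans _ _ _
   ((1 - u) / w * (Y ^- N / qpoch p p N) * \sum_(k < N.+1) rhs_term p Y a c e N k)).
  apply: eqmodM; first by eqmod_tac.
  apply: (eqmod_sum F R m N.+1 (rhs_term p Y b c e N) (rhs_term p Y a c e N)) => k lekN.
  have q1k := q1 k lekN; have q3k := q3 k; have q4k := q4 k.
  have Eba : eqmod_in R m b a by apply: eqmod_sym.
  by rewrite /rhs_term; eqmod_tac.
have RS : R (\sum_(k < N.+1) rhs_term p Y a c e N k).
  apply: (@in_subring_sum F R N.+1 (fun k => rhs_term p Y a c e N k)) => k lekN.
  exact: in_subring_rhs_term H lekN.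
rewrite /rhs_value; apply: eqmodM; last exact: eqmod_refl.
apply: eqmodM; first by eqmod_tac.
set C := 1 / qpoch p p N - _; have RC : R C by rewrite /C; in_subring_tac.
split; [by in_subring_tac|by in_subring_tac|].
exists (- (z * (Y ^- N / (1 - a) ^+ 2 * C))); first by in_subring_tac.
have -> : m * - (z * (Y ^- N / (1 - a) ^+ 2 * C)) = - ((m * z) * (Y ^- N / (1 - a) ^+ 2 * C)).
  by ring.
by rewrite -hz; ring.
Qed.

(** * Gluing congruences at three primes *)

(** The quotient is chosen coefficient by coefficient. Iterating this carries kernels computed in
    Q[q] or Q[q,a] up to all four variables. *)
Lemma map_poly_kernel (A B : nzRingType) (f : {rmorphism A -> B}) (pi : A) :
  (forall x, f x = 0 -> exists y, x = pi * y) ->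
  forall X, map_poly f X = 0 -> exists Y, X = pi%:P * Y.
Proof.
move=> kf X fX0.
(* A boolean equality, as [xchoose] requires. *)
have h i : exists y, X`_i == pi * y.
  have /kf[y ->] : f X`_i = 0 by rewrite -coef_map fX0 coef0.
  by exists y.
exists (\poly_(i < size X) xchoose (h i)); apply/polyP => i.
rewrite coefCM coef_poly; case: ltnP => [_|le_si]; first exact/eqP/(xchooseP (h i)).
by rewrite mulr0 nth_default.
Qed.


Lemma cross_multiply (F : fieldType) (b a x y g h : F) :
  g != 0 -> h != 0 -> a * (x / g) = b * (y / h) -> a * x * h = b * y * g.
Proof.
move=> g0 h0 E; have -> : a * x * h = a * (x / g) * (g * h) by field.
by rewrite E; field.
Qed.

(** The admissible denominators: a multiplicative set, because the three targets are domains. *)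
Definition off_kernels (D L1 L2 L3 : idomainType) (f1 : {rmorphism D -> L1})
    (f2 : {rmorphism D -> L2}) (f3 : {rmorphism D -> L3}) (G : D) : Prop :=
  [/\ f1 G != 0, f2 G != 0 & f3 G != 0].
Arguments off_kernels {D L1 L2 L3} f1 f2 f3 G.

Lemma off_kernels1 (D L1 L2 L3 : idomainType) (f1 : {rmorphism D -> L1})
    (f2 : {rmorphism D -> L2}) (f3 : {rmorphism D -> L3}) : off_kernels f1 f2 f3 1.
Proof. by split; rewrite rmorph1 oner_neq0. Qed.

Lemma off_kernelsM (D L1 L2 L3 : idomainType) (f1 : {rmorphism D -> L1})
    (f2 : {rmorphism D -> L2}) (f3 : {rmorphism D -> L3}) G H :
  off_kernels f1 f2 f3 G -> off_kernels f1 f2 f3 H -> off_kernels f1 f2 f3 (G * H).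
Proof. by move=> [? ? ?] [? ? ?]; split; rewrite rmorphM mulf_neq0. Qed.

Lemma off_kernels_neq0 (D L1 L2 L3 : idomainType) (f1 : {rmorphism D -> L1})
    (f2 : {rmorphism D -> L2}) (f3 : {rmorphism D -> L3}) G :
  off_kernels f1 f2 f3 G -> G != 0.
Proof. by case=> + _ _; apply: contraNneq => ->; rewrite rmorph0. Qed.

Definition localized (D L1 L2 L3 : idomainType) (f1 : {rmorphism D -> L1})
    (f2 : {rmorphism D -> L2}) (f3 : {rmorphism D -> L3}) (x : {fraction D}) : Prop :=
  exists A G, off_kernels f1 f2 f3 G /\ x = FracField.tofrac A / FracField.tofrac G.
Arguments localized {D L1 L2 L3} f1 f2 f3 x.

Lemma localized_poly (D L1 L2 L3 : idomainType) (f1 : {rmorphism D -> L1})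
    (f2 : {rmorphism D -> L2}) (f3 : {rmorphism D -> L3}) A :
  localized f1 f2 f3 (FracField.tofrac A).
Proof.
exists A, 1; split; first exact: off_kernels1.
by rewrite tofrac1 divr1.
Qed.

Lemma localizedB (D L1 L2 L3 : idomainType) (f1 : {rmorphism D -> L1})
    (f2 : {rmorphism D -> L2}) (f3 : {rmorphism D -> L3}) x y :
  localized f1 f2 f3 x -> localized f1 f2 f3 y -> localized f1 f2 f3 (x - y).
Proof.
move=> [A [G [kG ->]]] [B [H [kH ->]]]; exists (A * H - B * G), (G * H).
split; first exact: off_kernelsM.
have G0 : FracField.tofrac G != 0 by rewrite tofrac_eq0 (off_kernels_neq0 _ _ _ _ _ _ _ _ kG).
have H0 : FracField.tofrac H != 0 by rewrite tofrac_eq0 (off_kernels_neq0 _ _ _ _ _ _ _ _ kH).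
by rewrite tofracB !tofracM -mulNr addf_div // mulNr.
Qed.

Lemma localizedM (D L1 L2 L3 : idomainType) (f1 : {rmorphism D -> L1})
    (f2 : {rmorphism D -> L2}) (f3 : {rmorphism D -> L3}) x y :
  localized f1 f2 f3 x -> localized f1 f2 f3 y -> localized f1 f2 f3 (x * y).
Proof.
move=> [A [G [kG ->]]] [B [H [kH ->]]]; exists (A * B), (G * H).
split; first exact: off_kernelsM.
by rewrite !tofracM mulf_div.
Qed.

Definition localization (D L1 L2 L3 : idomainType) (f1 : {rmorphism D -> L1})
    (f2 : {rmorphism D -> L2}) (f3 : {rmorphism D -> L3}) : subring_pred {fraction D} :=
  @SubringPred _ (localized f1 f2 f3) (localized_poly _ _ _ _ f1 f2 f3 1)
    (localizedB _ _ _ _ f1 f2 f3) (localizedM _ _ _ _ f1 f2 f3).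
Arguments localization {D L1 L2 L3} f1 f2 f3.

Lemma unit_in_localization (D L1 L2 L3 : idomainType) (f1 : {rmorphism D -> L1})
    (f2 : {rmorphism D -> L2}) (f3 : {rmorphism D -> L3}) A :
  off_kernels f1 f2 f3 A -> unit_in (localization f1 f2 f3) (FracField.tofrac A).
Proof.
move=> kA; split.
- by rewrite tofrac_eq0 (off_kernels_neq0 _ _ _ _ _ _ _ _ kA).
- exact: localized_poly.
- by exists 1, A; split => //; rewrite tofrac1 mul1r.
Qed.

(* Since D/(pi) embeds in a domain, [pi] is prime: hence the three congruences
   glue, and no divisor of [pi1^2 pi2 pi3] can hide in a denominator. *)
Lemma localized_glue (D L1 L2 L3 : idomainType) (f1 : {rmorphism D -> L1})
    (f2 : {rmorphism D -> L2}) (f3 : {rmorphism D -> L3}) (pi1 pi2 pi3 : D)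
    (x y : {fraction D}) :
  (forall z, f1 z = 0 -> exists t, z = pi1 * t) ->
  (forall z, f2 z = 0 -> exists t, z = pi2 * t) ->
  (forall z, f3 z = 0 -> exists t, z = pi3 * t) ->
  f1 pi1 = 0 -> f2 pi2 = 0 -> f3 pi3 = 0 ->
  f2 pi1 != 0 -> f3 pi1 != 0 -> f3 pi2 != 0 -> f2 pi3 != 0 ->
  eqmod_in (localization f1 f2 f3) (FracField.tofrac pi1 * FracField.tofrac pi1) x y ->
  eqmod_in (localization f1 f2 f3) (FracField.tofrac pi2) x y ->
  eqmod_in (localization f1 f2 f3) (FracField.tofrac pi3) x y ->
  exists A G : D, G != 0 /\
    (forall E : D, (exists Y, G = E * Y) ->
       (exists Y, pi1 ^+ 2 * pi2 * pi3 = E * Y) -> E \is a GRing.unit) /\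
    x - y = (FracField.tofrac (pi1 ^+ 2 * pi2 * pi3) * FracField.tofrac A)
            / FracField.tofrac G.
Proof.
move=> k1 k2 k3 z1 z2 z3 n21 n31 n32 n23.
move=> [_ _ [_ [A1 [G1 [kG1 ->]]] E1]] [_ _ [_ [A2 [G2 [kG2 ->]]] E2]].
move=> [_ _ [_ [A3 [G3 [kG3 ->]]] E3]].
have frac0 G : off_kernels f1 f2 f3 G -> FracField.tofrac G != 0.
  by move=> kG; rewrite tofrac_eq0 (off_kernels_neq0 _ _ _ _ _ _ _ _ kG).
have G10 := frac0 _ kG1; have G20 := frac0 _ kG2; have G30 := frac0 _ kG3.
have nz (f : {rmorphism D -> L2}) t : f t != 0 -> t != 0.
  by apply: contraNneq => ->; rewrite rmorph0.
have nz3 (f : {rmorphism D -> L3}) t : f t != 0 -> t != 0.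
  by apply: contraNneq => ->; rewrite rmorph0.
have pi1n := nz _ _ n21; have pi3n := nz _ _ n23; have pi2n := nz3 _ _ n32.
(* Cross-multiplied, pi1^2 A1 G2 = pi2 A2 G1. The map [f2] kills the right-hand side but neither
   [pi1] nor [G2]. *)
have [B defB] : exists B, A1 = pi2 * B.
  apply: k2; have : f2 (pi1 * pi1 * A1 * G2) = f2 (pi2 * A2 * G1).
    congr (f2 _); apply/eqP; rewrite -tofrac_eq !tofracM; apply/eqP.
    by apply: cross_multiply; rewrite // -E1 -E2.
  rewrite !rmorphM z2 !mul0r => /eqP; rewrite !mulf_eq0 (negPf n21) /=.
  by case: kG2 => _ /negPf-> _; rewrite orbF => /eqP.
have [C defC] : exists C, B = pi3 * C.
  apply: k3; have : f3 (pi1 * pi1 * (pi2 * B) * G3) = f3 (pi3 * A3 * G1).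
    congr (f3 _); rewrite -defB; apply/eqP; rewrite -tofrac_eq !tofracM; apply/eqP.
    by apply: cross_multiply; rewrite // -E1 -E3.
  rewrite !rmorphM z3 !mul0r => /eqP; rewrite !mulf_eq0 (negPf n31) (negPf n32) /=.
  by case: kG3 => _ _ /negPf->; rewrite orbF => /eqP.
exists C, G1; split; first exact: off_kernels_neq0 kG1.
split; last first.
  by rewrite E1 defB defC !tofracM !mulrA.
(* Like [G1], its divisor E avoids the three kernels. So each prime factor of pi1^2 pi2 pi3 = E T
   divides the cofactor and can be cancelled, until E divides 1. *)
move=> E [Y defG] [T defT].
have [nE1 nE2 nE3] : off_kernels f1 f2 f3 E.
  by move: kG1; rewrite defG /off_kernels !rmorphM !mulf_eq0 !negb_or => -[/andP[? _] /andP[? _] /andP[? _]].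
have [T1 defT1] : exists T1, T = pi1 * T1.
  apply/k1/(mulfI nE1); rewrite -rmorphM -defT mulr0 expr2 !rmorphM z1.
  by rewrite !mul0r.
have defT' : pi1 * pi2 * pi3 = E * T1.
  by apply: (mulfI pi1n); rewrite [RHS]mulrCA -defT1 -defT expr2 !mulrA.
have [T2 defT2] : exists T2, T1 = pi1 * T2.
  by apply/k1/(mulfI nE1); rewrite -rmorphM -defT' mulr0 !rmorphM z1 !mul0r.
have defT'' : pi2 * pi3 = E * T2.
  by apply: (mulfI pi1n); rewrite [RHS]mulrCA -defT2 -defT' mulrA.
have [T3 defT3] : exists T3, T2 = pi2 * T3.
  by apply/k2/(mulfI nE2); rewrite -rmorphM -defT'' mulr0 !rmorphM z2 !mul0r.
have defT3' : pi3 = E * T3.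
  by apply: (mulfI pi2n); rewrite [RHS]mulrCA -defT3.
have [T4 defT4] : exists T4, T3 = pi3 * T4.
  by apply/k3/(mulfI nE3); rewrite -rmorphM -defT3' mulr0.
have ET4 : E * T4 = 1 by apply: (mulfI pi3n); rewrite [LHS]mulrCA -defT4 -defT3' mulr1.
by apply/unitrPr; exists T4.
Qed.

(** * Specializations of q and of a, and their principal kernels *)

Definition q_to (z : algC) : {rmorphism {poly rat} -> algC} :=
  GRing.RMorphism.clone _ _ (horner_eval z \o map_poly ratr) _.

Definition poly_to_frac (D : idomainType) : {rmorphism D -> {fraction D}} :=
  GRing.RMorphism.clone _ _ (@FracField.tofrac D) _.

(** The values lie in the fraction field because 1/t need not be a polynomial. *)
Definition a_to_inv (t : {poly rat}) : {rmorphism {poly {poly rat}} -> {fraction {poly rat}}} :=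
  GRing.RMorphism.clone _ _
    (horner_eval (FracField.tofrac t)^-1 \o map_poly (poly_to_frac {poly rat})) _.

Definition a_to (t : {poly rat}) : {rmorphism {poly {poly rat}} -> {poly rat}} :=
  GRing.RMorphism.clone _ _ (horner_eval t) _.

Definition map_poly2 (A B : nzRingType) (f : {rmorphism A -> B}) :
    {rmorphism {poly {poly A}} -> {poly {poly B}}} :=
  GRing.RMorphism.clone _ _ (map_poly (map_poly f)) _.

Definition map_poly1 (A B : nzRingType) (f : {rmorphism A -> B}) :
    {rmorphism {poly A} -> {poly B}} :=
  GRing.RMorphism.clone _ _ (map_poly f) _.
Arguments map_poly2 {A B} f.
Arguments map_poly1 {A B} f.

Lemma map_poly2_kernel (A B : nzRingType) (f : {rmorphism A -> B}) (pi : A) :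
  (forall x, f x = 0 -> exists y, x = pi * y) ->
  forall X, map_poly2 f X = 0 -> exists Y, X = pi%:P%:P * Y.
Proof. by move=> kf; apply: map_poly_kernel; apply: map_poly_kernel. Qed.

(** Phi_n is the minimal polynomial over Q of a primitive n-th root of unity. *)
Lemma q_to_kernel n (z : algC) : n.-primitive_root z ->
  forall x, q_to z x = 0 -> exists y, x = map_poly intr 'Phi_n * y.
Proof.
move=> prim_z x x0; case: (minCpolyP z) => p [Ep mon_p dv].
have -> : map_poly intr 'Phi_n = p.
  apply: (@map_poly_inj _ _ (ratr : {rmorphism rat -> algC})).
  rewrite -Ep (minCpoly_cyclotomic prim_z) -(Cintr_Cyclotomic prim_z) -map_poly_comp.
  by apply: eq_map_poly => i /=; rewrite ratr_int.
have : p %| x by rewrite -dv rootE; apply/eqP.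
by case/dvdpP => y ->; exists y; rewrite mulrC.
Qed.

Lemma q_to_Phi n (z : algC) : n.-primitive_root z -> q_to z (map_poly intr 'Phi_n) = 0.
Proof.
move=> prim_z; rewrite /q_to /= /horner_eval -map_poly_comp.
rewrite (@eq_map_poly _ _ _ intr) => [|i /=]; last by rewrite ratr_int.
rewrite (Cintr_Cyclotomic prim_z); apply/eqP; rewrite -/(root _ _).
by rewrite root_cyclotomic.
Qed.

Lemma a_to_kernel t x : a_to t x = 0 -> exists y, x = ('X - t%:P) * y.
Proof.
move=> /eqP x0; have /factor_theorem[y ->] : root x t by [].
by exists y; rewrite mulrC.
Qed.

(** The factor theorem does not apply, as 1 - tX is not monic. The quotient is the power series x/(1
    - tX), with coefficients [b m]. At m = deg x this coefficient is t^m x(1/t) = 0, and the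
    recursion keeps all later ones 0, so the series is a polynomial. *)
Lemma a_to_inv_kernel t : t != 0 ->
  forall x, a_to_inv t x = 0 -> exists y, x = (1 - 'X * t%:P) * y.
Proof.
move=> t0 x x0.
have tF0 : FracField.tofrac t != 0 by rewrite tofrac_eq0.
pose b m := \sum_(i < m.+1) x`_i * t ^+ (m - i).
have bS m : b m.+1 = t * b m + x`_m.+1.
  rewrite /b big_ord_recr /= subnn expr0 mulr1 mulr_sumr; congr (_ + _).
  apply: eq_bigr => -[i /=]; rewrite ltnS => le_im _.
  by rewrite subSn // exprS; ring.
have [->|xn0] := eqVneq x 0; first by exists 0; rewrite mulr0.
have b0 : b (size x).-1 = 0.
  apply/eqP; rewrite -tofrac_eq0; apply/eqP.
  have := x0; rewrite /a_to_inv /= /horner_eval (@horner_coef_wide _ (size x)) ?size_poly //.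
  move=> /(congr1 ( *%R (FracField.tofrac t ^+ (size x).-1))); rewrite mulr0 => E.
  rewrite -[RHS]E rmorph_sum prednK ?size_poly_gt0 // mulr_sumr; apply: eq_bigr => -[i /= lt_i] _.
  have le_i : (i <= (size x).-1)%N by rewrite -ltnS prednK // size_poly_gt0.
  have cancel (F : fieldType) (r s v : F) : v != 0 -> r * s = s * v * (r * v^-1).
    by move=> v0; field.
  rewrite coef_map exprVn; set T := FracField.tofrac t.
  have -> : T ^+ (size x).-1 = T ^+ ((size x).-1 - i) * T ^+ i by rewrite -exprD subnK.
  rewrite [LHS](_ : _ = FracField.tofrac x`_i * T ^+ ((size x).-1 - i)).
    by apply: cancel; rewrite expf_neq0.
  by rewrite -tofracXn -tofracM.
have bge m : ((size x).-1 <= m)%N -> b m = 0.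
  elim: m => [|m IH]; first by rewrite leqn0 => /eqP <-.
  rewrite leq_eqVlt => /orP[/eqP <- //|]; rewrite ltnS => le_m.
  by rewrite bS IH // mulr0 add0r nth_default // -(prednK (_ : 0 < size x)%N) ?size_poly_gt0 ?ltnS.
pose B := \poly_(m < (size x).-1) b m.
have BE m : B`_m = b m by rewrite coef_poly; case: ltnP => // /bge ->.
exists B; apply/polyP => m; rewrite mulrBl mul1r coefB -mulrA coefXM coefCM BE.
case: m => [|m]; first by rewrite subr0 /b big_ord1 expr0 mulr1.
by rewrite /= BE bS addrAC subrr add0r.
Qed.

(** * Specializations of Q[q,a,c,e] *)

(** The variables are nested as e, c, a, q from the outside in. This map changes the innermost
    layer, the next two change the two innermost ones. *)
Definition at_root (z : algC) : {rmorphism P -> {poly {poly {poly algC}}}} :=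
  map_poly1 (map_poly2 (q_to z)).
Definition at_qVn (n : nat) : {rmorphism P -> {poly {poly {fraction {poly rat}}}}} :=
  map_poly2 (a_to_inv 'X^n).
Definition at_qn (n : nat) : {rmorphism P -> {poly {poly {poly rat}}}} :=
  map_poly2 (a_to 'X^n).

Lemma map_poly1C (A B : nzRingType) (f : {rmorphism A -> B}) x : map_poly1 f x%:P = (f x)%:P.
Proof. exact: map_polyC. Qed.

Lemma map_poly1X (A B : nzRingType) (f : {rmorphism A -> B}) : map_poly1 f 'X = 'X.
Proof. exact: map_polyX. Qed.

Lemma map_poly2C (A B : nzRingType) (f : {rmorphism A -> B}) x : map_poly2 f x%:P = (map_poly1 f x)%:P.
Proof. exact: map_polyC. Qed.

Lemma map_poly2X (A B : nzRingType) (f : {rmorphism A -> B}) : map_poly2 f 'X = 'X.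
Proof. exact: map_polyX. Qed.

Lemma q_toX z : q_to z 'X = z.
Proof. by rewrite /q_to /= /horner_eval map_polyX hornerX. Qed.

Lemma a_to_invX t : a_to_inv t 'X = (FracField.tofrac t)^-1.
Proof. by rewrite /a_to_inv /= /horner_eval map_polyX hornerX. Qed.

Lemma a_to_invC t x : a_to_inv t x%:P = FracField.tofrac x.
Proof. by rewrite /a_to_inv /= /horner_eval map_polyC hornerC. Qed.

Lemma a_toX t : a_to t 'X = t.
Proof. exact: hornerX. Qed.

Lemma a_toC t x : a_to t x%:P = x.
Proof. exact: hornerC. Qed.

Definition map_polyCX := (map_poly1C, map_poly1X, map_poly2C, map_poly2X,
  q_toX, a_to_invX, a_to_invC, a_toX, a_toC).

Lemma at_root_q z : at_root z qP = z%:P%:P%:P.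
Proof. by rewrite /at_root /qP ?map_polyCX. Qed.

Lemma at_root_a z : at_root z aP = 'X%:P%:P.
Proof. by rewrite /at_root /aP ?map_polyCX. Qed.

Lemma at_root_c z : at_root z cP = 'X%:P.
Proof. by rewrite /at_root /cP ?map_polyCX. Qed.

Lemma at_root_e z : at_root z eP = 'X.
Proof. by rewrite /at_root /eP ?map_polyCX. Qed.

Lemma at_qVn_q n : at_qVn n qP = (FracField.tofrac 'X)%:P%:P.
Proof. by rewrite /at_qVn /qP ?map_polyCX. Qed.

Lemma at_qVn_a n : at_qVn n aP = (FracField.tofrac 'X^n)^-1%:P%:P.
Proof. by rewrite /at_qVn /aP ?map_polyCX. Qed.

Lemma at_qVn_c n : at_qVn n cP = 'X%:P.
Proof. by rewrite /at_qVn /cP ?map_polyCX. Qed.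

Lemma at_qVn_e n : at_qVn n eP = 'X.
Proof. by rewrite /at_qVn /eP ?map_polyCX. Qed.

Lemma at_qn_q n : at_qn n qP = 'X%:P%:P.
Proof. by rewrite /at_qn /qP ?map_polyCX. Qed.

Lemma at_qn_a n : at_qn n aP = 'X^n%:P%:P.
Proof. by rewrite /at_qn /aP ?map_polyCX. Qed.

Lemma at_qn_c n : at_qn n cP = 'X%:P.
Proof. by rewrite /at_qn /cP ?map_polyCX. Qed.

Lemma at_qn_e n : at_qn n eP = 'X.
Proof. by rewrite /at_qn /eP ?map_polyCX. Qed.

Lemma polyXn_sub_neq0 (i j : nat) : i != j -> 'X^i - 'X^j != 0 :> {poly rat}.
Proof.
apply: contraNneq => /eqP; rewrite subr_eq0 => /eqP /(congr1 (size : {poly rat} -> nat)).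
by rewrite !size_polyXn => -[->].
Qed.

Lemma prim_root_sub_neq0 n (z : algC) i j :
  n.-primitive_root z -> i != j %[mod n] -> z ^+ i - z ^+ j != 0.
Proof. by move=> prim_z ij; rewrite subr_eq0 (eq_prim_root_expr prim_z). Qed.

Lemma polyC2_sub_exp (A : nzRingType) (s t : A) m :
  s%:P%:P - t%:P%:P ^+ m = (s - t ^+ m)%:P%:P.
Proof. by rewrite !polyCB !polyC_exp. Qed.

Lemma polyC2_exp_sub_exp (A : nzRingType) (t : A) i j :
  t%:P%:P ^+ i - t%:P%:P ^+ j = (t ^+ i - t ^+ j)%:P%:P.
Proof. by rewrite !polyCB !polyC_exp. Qed.

Lemma polyC2_1_sub (A : nzRingType) (s t : A) m :
  1 - s%:P%:P * t%:P%:P ^+ m = (1 - s * t ^+ m)%:P%:P.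
Proof. by rewrite !polyCB !polyC1 !polyCM !polyC_exp. Qed.

Lemma polyX_sub_exp_neq0 (A : nzRingType) (t : A) m : 'X - t%:P ^+ m != 0.
Proof. by rewrite -polyC_exp polyXsubC_eq0. Qed.

Lemma polyXC_sub_exp_neq0 (A : nzRingType) (t : A) m : 'X%:P - t%:P%:P ^+ m != 0.
Proof. by rewrite -polyC_exp -polyCB polyC_eq0 polyX_sub_exp_neq0. Qed.

(** Exponents matter modulo n only at q = zeta_n; in the other two specializations q stays an
    indeterminate. *)
Lemma off_q_sub n z i j : n.-primitive_root z -> i != j %[mod n] ->
  off_kernels (at_root z) (at_qVn n) (at_qn n) (qP ^+ i - qP ^+ j).
Proof.
move=> prim_z ij; have ne_ij : i != j by apply: contraNneq ij => ->.
split; rewrite rmorphB !rmorphXn ?at_root_q ?at_qVn_q ?at_qn_q polyC2_exp_sub_exp !polyC_eq0.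
- by rewrite -!polyC_exp -polyCB polyC_eq0; apply: prim_root_sub_neq0 ij.
- by rewrite -!tofracXn -tofracB tofrac_eq0 polyXn_sub_neq0.
- exact: polyXn_sub_neq0.
Qed.

Lemma off_q n z : n.-primitive_root z -> off_kernels (at_root z) (at_qVn n) (at_qn n) qP.
Proof.
move=> prim_z; have n0 := prim_order_gt0 prim_z.
split; rewrite ?at_root_q ?at_qVn_q ?at_qn_q !polyC_eq0.
- apply/eqP => z0; have /eqP := prim_expr_order prim_z.
  by rewrite z0 expr0n gtn_eqF // eq_sym oner_eq0.
- by rewrite tofrac_eq0 polyX_eq0.
- by rewrite polyX_eq0.
Qed.

Lemma off_a n z : off_kernels (at_root z) (at_qVn n) (at_qn n) aP.
Proof.
split; rewrite ?at_root_a ?at_qVn_a ?at_qn_a !polyC_eq0.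
- by rewrite polyX_eq0.
- by rewrite invr_eq0 tofrac_eq0 expf_neq0 // polyX_eq0.
- by rewrite expf_neq0 // polyX_eq0.
Qed.

Lemma off_c n z : off_kernels (at_root z) (at_qVn n) (at_qn n) cP.
Proof. by split; rewrite ?at_root_c ?at_qVn_c ?at_qn_c !polyC_eq0 polyX_eq0. Qed.

Lemma off_e n z : off_kernels (at_root z) (at_qVn n) (at_qn n) eP.
Proof. by split; rewrite ?at_root_e ?at_qVn_e ?at_qn_e polyX_eq0. Qed.

Lemma off_c_sub n z m : off_kernels (at_root z) (at_qVn n) (at_qn n) (cP - qP ^+ m).
Proof.
by split; rewrite rmorphB rmorphXn ?at_root_c ?at_qVn_c ?at_qn_c ?at_root_q ?at_qVn_q ?at_qn_q
  polyXC_sub_exp_neq0.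
Qed.

Lemma off_e_sub n z m : off_kernels (at_root z) (at_qVn n) (at_qn n) (eP - qP ^+ m).
Proof.
by split; rewrite rmorphB rmorphXn ?at_root_e ?at_qVn_e ?at_qn_e ?at_root_q ?at_qVn_q ?at_qn_q
  polyX_sub_exp_neq0.
Qed.

Lemma at_root_a_sub z m : at_root z (aP - qP ^+ m) != 0.
Proof.
by rewrite rmorphB rmorphXn at_root_a at_root_q polyC2_sub_exp !polyC_eq0 polyX_sub_exp_neq0.
Qed.

Lemma at_qVn_a_sub n m : (0 < n)%N -> at_qVn n (aP - qP ^+ m) != 0.
Proof.
move=> n0; rewrite rmorphB rmorphXn at_qVn_a at_qVn_q polyC2_sub_exp !polyC_eq0.
have T0 : FracField.tofrac ('X : {poly rat}) != 0 by rewrite tofrac_eq0 polyX_eq0.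
have Tn0 := expf_neq0 n T0.
(* Multiplication by q^n turns q^-n - q^m into the nonzero polynomial 1 - q^(n+m). *)
rewrite tofracXn; apply: contraTneq (_ : 'X^0 - 'X^(n + m) != 0 :> {poly rat}); last first.
  by apply: polyXn_sub_neq0; rewrite eq_sym addn_eq0 negb_and -lt0n n0.
move=> E; rewrite negbK -tofrac_eq0 tofracB !tofracXn expr0 exprD.
by rewrite -(mulfV Tn0) -mulrBr E mulr0.
Qed.

Lemma at_qn_a_sub n m : m != n -> at_qn n (aP - qP ^+ m) != 0.
Proof.
move=> mn; rewrite rmorphB rmorphXn at_qn_a at_qn_q polyC2_sub_exp !polyC_eq0.
by apply: polyXn_sub_neq0; rewrite eq_sym.
Qed.

Lemma at_root_1_sub z m : at_root z (1 - aP * qP ^+ m) != 0.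
Proof.
rewrite rmorphB rmorph1 rmorphM rmorphXn at_root_a at_root_q polyC2_1_sub.
rewrite !polyC_eq0.
(* A polynomial in a with constant term 1. *)
apply/eqP => /(congr1 (fun x : {poly algC} => x.[0])) /eqP.
by rewrite !hornerE ?mul0r ?subr0 oner_eq0.
Qed.

Lemma at_qVn_1_sub n m : m != n -> at_qVn n (1 - aP * qP ^+ m) != 0.
Proof.
move=> mn; rewrite rmorphB rmorph1 rmorphM rmorphXn at_qVn_a at_qVn_q polyC2_1_sub.
rewrite !polyC_eq0.
have T0 : FracField.tofrac ('X : {poly rat}) != 0 by rewrite tofrac_eq0 polyX_eq0.
have Tn0 := expf_neq0 n T0.
rewrite tofracXn; apply: contraTneq (_ : 'X^n - 'X^m != 0 :> {poly rat}); last first.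
  by apply: polyXn_sub_neq0; rewrite eq_sym.
move=> E; rewrite negbK -tofrac_eq0 tofracB !tofracXn.
by rewrite -[X in X - _]mulr1 -[X in _ - X](mulVKf Tn0) -mulrBr E mulr0.
Qed.

Lemma at_qn_1_sub n m : (0 < n)%N -> at_qn n (1 - aP * qP ^+ m) != 0.
Proof.
move=> n0; rewrite rmorphB rmorph1 rmorphM rmorphXn at_qn_a at_qn_q polyC2_1_sub.
rewrite !polyC_eq0 -exprD.
by apply: (polyXn_sub_neq0 0); rewrite eq_sym addn_eq0 negb_and -lt0n n0.
Qed.

Lemma off_a_sub n z m : (0 < n)%N -> m != n ->
  off_kernels (at_root z) (at_qVn n) (at_qn n) (aP - qP ^+ m).
Proof.
by move=> n0 mn; split; [apply: at_root_a_sub|apply: at_qVn_a_sub|apply: at_qn_a_sub].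
Qed.

Lemma off_1_sub n z m : (0 < n)%N -> m != n ->
  off_kernels (at_root z) (at_qVn n) (at_qn n) (1 - aP * qP ^+ m).
Proof.
by move=> n0 mn; split; [apply: at_root_1_sub|apply: at_qVn_1_sub|apply: at_qn_1_sub].
Qed.

(** [PhiP] is defined by evaluation at q; as a constant in a, c, e it has the shape of the
    generators given by [map_poly_kernel]. *)
Lemma PhiP_const n : PhiP n = (map_poly intr 'Phi_n : {poly rat})%:P%:P%:P.
Proof.
pose cc := GRing.RMorphism.clone _ _ ((polyC \o polyC) \o polyC : {poly rat} -> P) _.
have -> : PhiP n = (map_poly cc (map_poly intr 'Phi_n)).[cc 'X].
  rewrite /PhiP -map_poly_comp; congr (_.[_]).
  by apply: eq_map_poly => i; exact/esym/(rmorph_int cc).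
rewrite horner_map; congr (cc _).
rewrite -[RHS]comp_polyXr /comp_poly -map_poly_comp; congr (_.[_]).
by apply: eq_map_poly => i; exact/esym/(rmorph_int (polyC : {rmorphism rat -> {poly rat}})).
Qed.

Definition loc (z : algC) (n : nat) : subring_pred K :=
  localization (at_root z) (at_qVn n) (at_qn n).

Lemma at_root_kernel n (z : algC) : n.-primitive_root z ->
  forall x, at_root z x = 0 -> exists y, x = PhiP n * y.
Proof.
move=> prim_z; rewrite PhiP_const.
apply: map_poly_kernel; apply: map_poly2_kernel; exact: q_to_kernel.
Qed.

Lemma at_qVn_kernel n x : at_qVn n x = 0 -> exists y, x = (1 - aP * qP ^+ n) * y.
Proof.
have -> : 1 - aP * qP ^+ n = (1 - 'X * ('X^n)%:P)%:P%:P.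
  by rewrite polyC_exp -polyC2_1_sub.
apply: map_poly2_kernel; apply: a_to_inv_kernel.
by rewrite expf_neq0 // polyX_eq0.
Qed.

Lemma at_qn_kernel n x : at_qn n x = 0 -> exists y, x = (aP - qP ^+ n) * y.
Proof.
have -> : aP - qP ^+ n = ('X - ('X^n)%:P)%:P%:P.
  by rewrite polyC_exp -polyC2_sub_exp.
apply: map_poly2_kernel; exact: a_to_kernel.
Qed.

Lemma at_root_Phi n (z : algC) : n.-primitive_root z -> at_root z (PhiP n) = 0.
Proof.
move=> prim_z; rewrite PhiP_const /at_root.
by rewrite map_poly1C map_poly2C map_poly1C q_to_Phi.
Qed.

Lemma Phi_rat_neq0 n : map_poly intr 'Phi_n != 0 :> {poly rat}.
Proof. exact: monic_neq0 (monic_map _ (Cyclotomic_monic n)). Qed.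

Lemma at_qVn_Phi n : at_qVn n (PhiP n) != 0.
Proof.
rewrite PhiP_const /at_qVn map_poly2C map_poly1C a_to_invC !polyC_eq0 tofrac_eq0.
exact: Phi_rat_neq0.
Qed.

Lemma at_qn_Phi n : at_qn n (PhiP n) != 0.
Proof.
by rewrite PhiP_const /at_qn map_poly2C map_poly1C a_toC !polyC_eq0 Phi_rat_neq0.
Qed.

Lemma at_qVn_root n : at_qVn n (1 - aP * qP ^+ n) = 0.
Proof.
rewrite rmorphB rmorph1 rmorphM rmorphXn at_qVn_a at_qVn_q polyC2_1_sub -tofracXn.
by rewrite mulVf ?subrr // tofrac_eq0 expf_neq0 // polyX_eq0.
Qed.

Lemma at_qn_root n : at_qn n (aP - qP ^+ n) = 0.
Proof. by rewrite rmorphB rmorphXn at_qn_a at_qn_q polyC2_sub_exp subrr. Qed.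

Lemma congr_mod_glue n (A B : K) (z : algC) : n.-primitive_root z ->
  eqmod_in (loc z n) ((PhiP n)%:F * (PhiP n)%:F) A B ->
  eqmod_in (loc z n) (1 - aP * qP ^+ n)%:F A B ->
  eqmod_in (loc z n) (aP - qP ^+ n)%:F A B ->
  congr_mod A B (PhiP n ^+ 2 * (1 - aP * qP ^+ n) * (aP - qP ^+ n)).
Proof.
move=> prim_z; have n0 := prim_order_gt0 prim_z.
apply: localized_glue.
- exact: at_root_kernel.
- exact: at_qVn_kernel.
- exact: at_qn_kernel.
- exact: at_root_Phi.
- exact: at_qVn_root.
- exact: at_qn_root.
- exact: at_qVn_Phi.
- exact: at_qn_Phi.
- exact: at_qn_1_sub.
- exact: at_qVn_a_sub.
Qed.

(** * Powers of q as admissible parameters, and conclusion *)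

Lemma qv_exp m : qv ^+ m = (qP ^+ m)%:F.
Proof. by rewrite tofracXn. Qed.

Lemma qv_sub_neq0 i j : i != j -> qv ^+ i - qv ^+ j != 0.
Proof.
move=> ij; rewrite !qv_exp -tofracB tofrac_eq0.
(* The specialization a = 1 merely serves as a morphism that leaves q an indeterminate. *)
suff : at_qn 0 (qP ^+ i - qP ^+ j) != 0 by apply: contraNneq => ->; rewrite rmorph0.
by rewrite rmorphB !rmorphXn at_qn_q polyC2_exp_sub_exp !polyC_eq0 polyXn_sub_neq0.
Qed.

Lemma unit_in_q_sub n z i j : n.-primitive_root z -> i != j %[mod n] ->
  unit_in (loc z n) (qv ^+ i - qv ^+ j).
Proof.
move=> prim_z ij; rewrite !qv_exp -tofracB.
by apply: unit_in_localization; apply: off_q_sub.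
Qed.

Lemma two_neq0 : 2%:R != 0 :> K.
Proof.
have -> : 2%:R = ((2%:R : rat)%:P%:P%:P%:P)%:F :> K.
  have natC (A : nzRingType) : (2%:R : A)%:P = 2%:R.
    exact: (rmorph_nat (polyC : {rmorphism A -> {poly A}})).
  by rewrite !natC; apply/esym/(rmorph_nat (poly_to_frac P)).
by rewrite tofrac_eq0 !polyC_eq0.
Qed.

(** Since n > 1 >= r, the quotient is nonnegative and the absolute value in the definition of N
    loses nothing. *)
Lemma exists_exponents (n d : nat) (r : int) : (1 < n)%N -> (2 <= d)%N -> r = 1 \/ r = -1 ->
  (n%:Z = r %[mod d%:Z])%Z ->
  n%:Z = d%:Z * `|((n%:Z - r) %/ d%:Z)%Z|%N%:Z + r.
Proof.
move=> n1 d2 hr /eqP; rewrite eqz_mod_dvd => /divzK E.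
have d0 : (0 < d%:Z) by lia.
have : 0 <= ((n%:Z - r) %/ d%:Z)%Z by rewrite divz_ge0 //; lia.
by move=> /gez0_abs ->; lia.
Qed.

(** As n = dN + r with r = 1 or -1, n is coprime to d; so n would divide i, but i <= N < n. *)
Lemma not_dvd_multiple (n d N i : nat) (r : int) :
  (1 < n)%N -> (2 <= d)%N -> r = 1 \/ r = -1 -> n%:Z = d%:Z * N%:Z + r ->
  (0 < i <= N)%N -> ~~ (n %| d * i)%N.
Proof.
move=> n1 d2 hr defn /andP[i0 leiN].
have cop : coprime n d.
  have dvr : forall g, (g %| n)%N -> (g %| d)%N -> (g %| 1)%N.
    move=> g gn gd; have : (g%:Z %| r)%Z.
      have -> : r = n%:Z - d%:Z * N%:Z by lia.
      by rewrite rpredB ?dvdz_mulr.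
    by case: hr => ->.
  by rewrite /coprime -dvdn1; apply: dvr; rewrite ?dvdn_gcdl ?dvdn_gcdr.
rewrite Gauss_dvdr //; apply: contraTN i0 => /dvdn_leq; nia.
Qed.

Lemma one_sub_div (F : fieldType) (x u y : F) :
  u != 0 -> 1 - x / u * y = (u - x * y) / u.
Proof. by move=> u0; field. Qed.

Lemma expfz_split (F : fieldType) (x : F) (n d N : nat) (r : int) :
  x != 0 -> n%:Z = d%:Z * N%:Z + r -> x ^ r * x ^+ d ^+ N = x ^+ n.
Proof.
by move=> x0 E; rewrite -exprM !exprnP -expfzDr // E PoszM addrC.
Qed.

Lemma lhs_termE (F : fieldType) (x a c e : F) (d k : nat) (r : int) : x != 0 ->
  (1 - x ^ (2 * d%:Z * k%:Z + r)) / (1 - x) *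
  (qpoch (x ^ r) (x ^+ d) k ^+ 2 * qpoch (c * x ^ r) (x ^+ d) k
     * qpoch (e * x ^ r) (x ^+ d) k * qpoch (a * x ^ r) (x ^+ d) k
     * qpoch (x ^ r / a) (x ^+ d) k)
  / (qpoch (x ^+ d) (x ^+ d) k ^+ 2 * qpoch (x ^+ d / c) (x ^+ d) k
     * qpoch (x ^+ d / e) (x ^+ d) k * qpoch (x ^+ d / a) (x ^+ d) k
     * qpoch (a * x ^+ d) (x ^+ d) k)
  * (x ^ (2 * d%:Z - 3 * r) / (c * e)) ^+ k
  = lhs_term (x ^+ d) (x ^ r) a c e (1 - x) k.
Proof.
move=> x0; rewrite /lhs_term.
have -> : x ^ (2 * d%:Z * k%:Z + r) = x ^ r * (x ^+ d) ^+ (2 * k).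
  by rewrite -exprM exprnP -expfzDr //; congr (_ ^ _); lia.
have -> // : x ^ (2 * d%:Z - 3 * r) = x ^+ d ^+ 2 / (x ^ r) ^+ 3.
by rewrite -exprM !exprnP exprz_exp invr_expz -expfzDr //; congr (_ ^ _); lia.
Qed.

Lemma rhs_termE (F : fieldType) (x a c e : F) (d N k : nat) (r : int) : x != 0 ->
  (qpoch (x ^ (2 * r + d%:Z * k%:Z)) (x ^+ d) (N - k)
     * qpoch (x ^ (d%:Z - r) / (c * e)) (x ^+ d) k * qpoch (a * x ^ r) (x ^+ d) k
     * qpoch (x ^ r / a) (x ^+ d) k * qpoch (x ^ r) (x ^+ d) k)
  / (qpoch (x ^+ d) (x ^+ d) k * qpoch (x ^+ d / c) (x ^+ d) k
     * qpoch (x ^+ d / e) (x ^+ d) k)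
  * x ^+ (d * k)
  = rhs_term (x ^+ d) (x ^ r) a c e N k.
Proof.
move=> x0; rewrite /rhs_term.
have -> : x ^ (2 * r + d%:Z * k%:Z) = (x ^ r) ^+ 2 * x ^+ d ^+ k.
  by rewrite -exprM !exprnP exprz_exp -expfzDr //; congr (_ ^ _); lia.
have -> : x ^ (d%:Z - r) = x ^+ d / x ^ r.
  by rewrite exprnP invr_expz -expfzDr.
by rewrite exprM.
Qed.

Lemma expfz_prefactor (F : fieldType) (x : F) (n d N : nat) (r : int) :
  (0 < d)%N -> n%:Z = d%:Z * N%:Z + r ->
  x ^ ((r * (r - n%:Z)) %/ d%:Z)%Z = (x ^ r) ^- N.
Proof.
move=> d0 defn; have -> : r * (r - n%:Z) = (- (r * N%:Z)) * d%:Z by rewrite defn; lia.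
by rewrite mulzK ?exprnP ?exprz_exp ?invr_expz //; lia.
Qed.

Lemma unit_in_expz (F : fieldType) (R : subring_pred F) (x : F) (r : int) :
  unit_in R x -> unit_in R (x ^ r).
Proof.
by move=> Ux; case: r => m; [exact: unit_inX|apply: unit_inV; exact: unit_inX].
Qed.

Lemma admissible_powers (F : fieldType) (R : subring_pred F) (phi q a c e : F)
    (n d N : nat) (r : int) :
  (1 < n)%N -> (2 <= d)%N -> r = 1 \/ r = -1 -> n%:Z = d%:Z * N%:Z + r ->
  R phi -> unit_in R q -> unit_in R a -> unit_in R c -> unit_in R e ->
  2%:R != 0 :> F ->
  (forall i j, i != j -> q ^+ i - q ^+ j != 0) ->
  (forall i j, i != j %[mod n] -> unit_in R (q ^+ i - q ^+ j)) ->
  (forall m, unit_in R (c - q ^+ m)) -> (forall m, unit_in R (e - q ^+ m)) ->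
  (forall m, m != n -> unit_in R (a - q ^+ m)) ->
  (forall m, m != n -> unit_in R (1 - a * q ^+ m)) ->
  (exists2 z, R z & 1 - q ^+ n = phi * z) ->
  admissible R phi (q ^+ d) (q ^ r) (q ^+ n) a c e (1 - q) N.
Proof.
move=> n1 d2 hr defn Rphi Uq Ua Uc Ue two0 qn0 qU cU eU aU aU' hz.
have ndvd i : (i < N)%N -> ~~ (n %| d * i.+1)%N.
  by move=> lt_iN; apply: (not_dvd_multiple n d N i.+1 r).
(* Otherwise d would divide r. This keeps a - q^(d(i+1)) and 1 - a q^(d(i+1)) apart from the two
   primes containing a. *)
have neq i : (d * i.+1)%N != n.
  apply/eqP => E; have : (d%:Z %| r)%Z.
    have -> : r = d%:Z * (i.+1%:Z - N%:Z) by move: defn; rewrite -E; lia.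
    exact: dvdz_mulr.
  by case: hr => ->; rewrite dvdzE /= dvdn1; lia.
have UqX m : unit_in R (q ^+ m) by apply: unit_inX.
have [q0 _ _] := Uq; have [a0 _ _] := Ua; have [c0 _ _] := Uc; have [e0 _ _] := Ue.
have pE i : q ^+ d * q ^+ d ^+ i = q ^+ (d * i.+1) by rewrite -exprS -exprM.
have pV x i : x != 0 -> 1 - q ^+ d / x * q ^+ d ^+ i = (x - q ^+ (d * i.+1)) / x.
  by move=> x0; rewrite one_sub_div // pE.
have one_sub m : 1 - q ^+ m = q ^+ 0 - q ^+ m by rewrite expr0.
split => //.
- exact: unit_in_expz.
- have -> : 1 - q = q ^+ 0 - q ^+ 1 by rewrite expr0 expr1.
  by apply: qU; rewrite mod0n modn_small.
- by have := aU' 0%N; rewrite expr0 mulr1; apply; lia.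
- move=> i; rewrite -exprM; case: hr => ->.
    by rewrite expr1z -exprS one_sub qn0.
  (* For r = -1 the factor vanishes only if di = 1, which d >= 2 excludes. *)
  have -> : 1 - q ^ (-1) * q ^+ (d * i) = (q ^+ 1 - q ^+ (d * i)) / q.
    by rewrite exprN1; field.
  rewrite mulf_neq0 ?invr_eq0 //; apply: qn0; apply/eqP => E.
  have : (d %| 1)%N by rewrite E dvdn_mulr.
  by rewrite dvdn1; lia.
- by move=> i; rewrite pE one_sub; apply: qn0; rewrite eq_sym muln_eq0; lia.
- move=> i; rewrite pV ?expf_neq0 // mulf_neq0 ?invr_eq0 ?expf_neq0 //.
  by apply: qn0; rewrite eq_sym.
- move=> i lt_iN; rewrite pE one_sub; apply: qU.
  by rewrite mod0n eq_sym; apply: ndvd.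
(* The additional factor u = q^n does not change the exponent modulo n. *)
- move=> i lt_iN; rewrite mulrAC pE -exprD one_sub; apply: qU.
  by rewrite mod0n modnDr eq_sym; apply: ndvd.
- move=> i lt_iN; rewrite pV ?expf_neq0 //; apply: unit_inM; last exact: unit_inV.
  by apply: qU; rewrite modnn eq_sym; apply: ndvd.
- by move=> i; rewrite pV //; apply: unit_inM; last exact: unit_inV.
- by move=> i; rewrite pV //; apply: unit_inM; last exact: unit_inV.
- by move=> i; rewrite pV //; apply: unit_inM; [exact: aU|exact: unit_inV].
- by move=> i; rewrite -mulrA pE; apply: aU'.
- by rewrite (expfz_split _ _ n).
Qed.

Lemma admissible_qv (n d N : nat) (r : int) (z : algC) :
  n.-primitive_root z -> (1 < n)%N -> (2 <= d)%N -> r = 1 \/ r = -1 ->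
  n%:Z = d%:Z * N%:Z + r ->
  admissible (loc z n) (PhiP n)%:F (qv ^+ d) (qv ^ r) (qv ^+ n) av cv ev (1 - qv) N.
Proof.
move=> prim_z n1 d2 hr defn; have n0 : (0 < n)%N by lia.
apply: admissible_powers => //.
- exact: localized_poly.
- by apply: unit_in_localization; apply: off_q.
- by apply: unit_in_localization; apply: off_a.
- by apply: unit_in_localization; apply: off_c.
- by apply: unit_in_localization; apply: off_e.
- exact: two_neq0.
- exact: qv_sub_neq0.
- by move=> i j; apply: unit_in_q_sub.
- move=> m; rewrite qv_exp -tofracB.
  by apply: unit_in_localization; apply: off_c_sub.
- move=> m; rewrite qv_exp -tofracB.
  by apply: unit_in_localization; apply: off_e_sub.
- move=> m mn; rewrite qv_exp -tofracB.
  by apply: unit_in_localization; apply: off_a_sub.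
- move=> m mn; rewrite qv_exp -tofracM -tofrac1 -tofracB.
  by apply: unit_in_localization; apply: off_1_sub.
(* Divisibility by Phi_n(q) is read off from the kernel of q = zeta_n, where q^n becomes 1. *)
- have [y Ey] : exists y, 1 - qP ^+ n = PhiP n * y.
    apply: (at_root_kernel n z prim_z).
    rewrite rmorphB rmorph1 rmorphXn at_root_q -!polyC_exp (prim_expr_order prim_z).
    by rewrite !polyC1 subrr.
  exists y%:F; first exact: localized_poly.
  by rewrite -tofracM -Ey tofracB tofrac1 qv_exp.
Qed.

Lemma lhs_rhs_eqmod (F : fieldType) (R : subring_pred F) phi p Y u a c e w N :
  admissible R phi p Y u a c e w N ->
  [/\ eqmod_in R (phi * phi) (\sum_(k < N.+1) lhs_term p Y a c e w k) (rhs_value p Y u a c e w N),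
      eqmod_in R (1 - a * u) (\sum_(k < N.+1) lhs_term p Y a c e w k) (rhs_value p Y u a c e w N)
    & eqmod_in R (a - u) (\sum_(k < N.+1) lhs_term p Y a c e w k) (rhs_value p Y u a c e w N)].
Proof.
move=> H; have Ua := adm_a H; have Up := adm_p H; have UY := adm_Y H.
have Uu : unit_in R u by rewrite (adm_u H); unit_in_tac.
have R1 := in_subring1 _ R.
split.
- exact: eqmod_trans (lhs_twisted_mod _ _ _ _ _ _ _ _ _ _ _ H) (twisted_rhs_mod _ _ _ _ _ _ _ _ _ _ _ H).
- apply: (lhs_rhs_mod_at _ _ _ _ _ _ _ _ _ _ _ _ u^-1 H); first by right.
    split; [by in_subring_tac|by in_subring_tac|exists (- u^-1); first by in_subring_tac].
    by have [u0 _ _] := Uu; field.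
  by exists (a - u); first by in_subring_tac.
- apply: (lhs_rhs_mod_at _ _ _ _ _ _ _ _ _ _ _ _ u H); first by left.
    by split; [by in_subring_tac|by in_subring_tac|exists 1; rewrite ?mulr1].
  by exists (1 - a * u); [by in_subring_tac|rewrite mulrC].
Qed.

Theorem theorem3p5 (n d : nat) (r : int) :
  (1 < n)%N -> (2 <= d)%N -> (r = 1 \/ r = -1) ->
  (n%:Z = r %[mod d%:Z])%Z ->
  let N := `|((n%:Z - r) %/ d%:Z)%Z|%N in
  let q := qv in let a := av in let c := cv in let e := ev in
  let qd := q ^+ d in
  congr_mod
    (\sum_(k < N.+1)
       qint (2 * d%:Z * k%:Z + r) *
       (poch (q ^ r) qd k ^+ 2 * poch (c * q ^ r) qd k * poch (e * q ^ r) qd k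
          * poch (a * q ^ r) qd k * poch (q ^ r / a) qd k)
       / (poch qd qd k ^+ 2 * poch (qd / c) qd k * poch (qd / e) qd k
          * poch (qd / a) qd k * poch (a * qd) qd k)
       * (q ^ (2 * d%:Z - 3 * r) / (c * e)) ^+ k)
    (qint n%:Z * Qq n d r N *
     \sum_(k < N.+1)
       (poch (q ^ (2 * r + d%:Z * k%:Z)) qd (N - k)
          * poch (q ^ (d%:Z - r) / (c * e)) qd k * poch (a * q ^ r) qd k
          * poch (q ^ r / a) qd k * poch (q ^ r) qd k)
       / (poch qd qd k * poch (qd / c) qd k * poch (qd / e) qd k)
       * q ^+ (d * k))
    (PhiP n ^+ 2 * (1 - aP * qP ^+ n) * (aP - qP ^+ n)).
Proof.
move=> n1 d2 hr hmod N q a c e qd.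
have defn : n%:Z = d%:Z * N%:Z + r := exists_exponents n d r n1 d2 hr hmod.
(* From here on N is known only through n = dN + r. *)
clearbody N.
have [z prim_z] := @C_prim_root_exists n (ltnW n1).
have adm := admissible_qv n d N r z prim_z n1 d2 hr defn.
have [q0 _ _] : unit_in (loc z n) qv by apply: unit_in_localization; apply: off_q.
have [E1 E2 E3] := lhs_rhs_eqmod _ _ _ _ _ _ _ _ _ _ _ adm.
have -> : \sum_(k < N.+1)
       qint (2 * d%:Z * k%:Z + r) *
       (poch (q ^ r) qd k ^+ 2 * poch (c * q ^ r) qd k * poch (e * q ^ r) qd k
          * poch (a * q ^ r) qd k * poch (q ^ r / a) qd k)
       / (poch qd qd k ^+ 2 * poch (qd / c) qd k * poch (qd / e) qd k
          * poch (qd / a) qd k * poch (a * qd) qd k)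
       * (q ^ (2 * d%:Z - 3 * r) / (c * e)) ^+ k
   = \sum_(k < N.+1) lhs_term qd (q ^ r) a c e (1 - q) k.
  (* [poch] and [qint] agree with the expressions in [lhs_termE] by conversion. *)
  by apply: eq_bigr => k _; exact: lhs_termE.
have -> : qint n%:Z * Qq n d r N *
     (\sum_(k < N.+1)
       (poch (q ^ (2 * r + d%:Z * k%:Z)) qd (N - k)
          * poch (q ^ (d%:Z - r) / (c * e)) qd k * poch (a * q ^ r) qd k
          * poch (q ^ r / a) qd k * poch (q ^ r) qd k)
       / (poch qd qd k * poch (qd / c) qd k * poch (qd / e) qd k)
       * q ^+ (d * k))
  = rhs_value qd (q ^ r) (q ^+ n) a c e (1 - q) N.
  rewrite /rhs_value /Qq /qint (expfz_prefactor _ _ _ _ N) //; last exact: ltnW.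
  by congr (_ * _); apply: eq_bigr => k _; exact: rhs_termE.
apply: (congr_mod_glue n _ _ z prim_z).
- exact: E1.
- by move: E2; rewrite tofracB tofrac1 tofracM tofracXn.
- by move: E3; rewrite tofracB tofracXn.
Qed.
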